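(* Suppose that for every non-archimedean local field $\mathbb F$ of characteristic $0$ and every finite-dimensional $\mathbb F$-vector space $V$, every $GL(V)$-invariant distribution on $GL(V)\times V\times V^*$ is invariant under $\sigma$. Then for every non-archimedean local field $\mathbb F$ of characteristic $0$ and every decomposition $W=V\oplus U$ of a finite-dimensional $\mathbb F$-vector space $W$ of dimension $n+1\ge 2$ with $\dim V=n$, every distribution on $GL(W)$ which is invariant under the adjoint (conjugation) action of $GL(V)$ is invariant by transposition.
   Context: For a totally disconnected, locally compact Hausdorff space $X$ countable at infinity, $\mathcal S(X)$ is the space of locally constant compactly supported functions $X\to\mathbb C$ and distributions are linear forms on $\mathcal S(X)$; $T$ is invariant under a homeomorphism $\phi$ if $\langle T,f\circ\phi\rangle=\langle T,f\rangle$ for all $f$. The group $GL(V)$ acts on $GL(V)\times V\times V^*$ by $g(x,v,v^* )=(gxg^{-1},gv,{}^tg^{-1}v^* )$. Choose a basis $(e_i)$ of $V$ with dual basis $(e_i^* )$, let $u:V\to V^*$ be the linear map with $u(e_i)=e_i^*$; then $\sigma(x,v,v^* )=(u^{-1}\,{}^tx\,u,\;u^{-1}(v^* ),\;u(v))$. Its action on invariant distributions is independent of the basis. $GL(V)$ is embedded in $GL(W)$ acting trivially on $U$. Transposition on $GL(W)$ is $g\mapsto{}^tg$ after identifying $GL(W)$ with $GL(n+1,\mathbb F)$ by means of a basis of $V$ completed by a non-zero vector of $U$; its action on $GL(V)$-invariant distributions does not depend on these choices. *)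

(* Defs.v *)
From HB Require Import structures.
From mathcomp Require Import all_boot all_order all_algebra.
From mathcomp Require Import all_classical all_reals all_analysis.
From mathcomp Require Import complex.

Set Implicit Arguments.
Unset Strict Implicit.
Unset Printing Implicit Defensive.

Import Order.TTheory GRing.Theory Num.Theory passmx.

Local Open Scope classical_set_scope.
Local Open Scope ring_scope.

(* A non-archimedean local field: a field with a nontrivial ultrametric
   absolute value whose topology is locally compact.  Completeness,
   discreteness of the value group and finiteness of the residue field are
   consequences.  The absolute value only serves to pin down the topology, and
   the characteristic is not constrained. *)
HB.mixin Record isNonArchLocalField (R : realType) F
    & GRing.Field F & Topological F := {
  absv : F -> R;
  absv_ge0 : forall x, 0 <= absv x;
  absv_eq0 : forall x, (absv x == 0) = (x == 0);
  absvM : forall x y, absv (x * y) = absv x * absv y;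
  absvD_max : forall x y, absv (x + y) <= Num.max (absv x) (absv y);
  absv_nontrivial : exists2 x, x != 0 & absv x != 1;
  nbhs_absvE : forall (x : F) (A : set F),
    nbhs x A <-> exists2 e : R, 0 < e & [set y | absv (y - x) < e] `<=` A;
  locally_compact_absv : locally_compact [set: F]
}.

#[short(type="nonArchLocalFieldType")]
HB.structure Definition NonArchLocalField (R : realType) :=
  {F of GRing.Field F & Topological F & isNonArchLocalField R F}.

Section Schwartz.
Variables (R : realType) (X : topologicalType).

Definition locally_constant (f : X -> R[i]) :=
  forall x, \forall y \near x, f y = f x.

Definition compactly_supported (f : X -> R[i]) :=
  compact (closure [set x | f x != 0]).

Definition schwartz_pred : {pred X -> R[i]^o} :=
  fun f => `[< locally_constant f /\ compactly_supported f >].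

Lemma schwartz_submod_closed : subsemimod_closed schwartz_pred.
Proof.
split; first split.
- apply/asboolP; split; first by move=> x; apply: nearW.
  rewrite /compactly_supported (_ : [set _ | _] = set0) ?closure0.
    exact: compact0.
  by apply/seteqP; split=> x //=; rewrite eqxx.
- move=> f g /asboolP[lf cf] /asboolP[lg cg]; apply/asboolP; split.
    move=> x; move: (lf x) (lg x); apply: filterS2 => y.
    by rewrite /GRing.add /= => -> ->.
  apply: (subclosed_compact (@closed_closure _ _) (compactU cf cg)).
  rewrite -closureU; apply: closureS => x /= nz.
  case: (eqVneq (f x) 0) => fx0; [right|by left].
  by apply: contraNneq nz => gx0; rewrite /GRing.add /= fx0 gx0 addr0.
- move=> a f /asboolP[lf cf]; apply/asboolP; split.
    move=> x; move: (lf x); apply: filterS => y.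
    by rewrite /GRing.scale /= => ->.
  apply: (subclosed_compact (@closed_closure _ _) cf).
  apply: closureS => x /=; apply: contraNN => /eqP fx0.
  by apply/eqP; change (a * f x = 0); rewrite fx0 mulr0.
Qed.

HB.instance Definition _ :=
  GRing.isSubSemiModClosed.Build R[i] (X -> R[i]^o) schwartz_pred
    schwartz_submod_closed.

Record schwartz := Schwartz {
  schwartz_val :> X -> R[i]^o;
  schwartzP : schwartz_val \in schwartz_pred
}.

HB.instance Definition _ := [isSub for schwartz_val].
HB.instance Definition _ := [Choice of schwartz by <:].
HB.instance Definition _ := [SubChoice_isSubLmodule of schwartz by <:].

Definition schwartz_distribution := {linear schwartz -> R[i]^o}.

Record homeomorphism := Homeomorphism {
  homeo_fun :> X -> X;
  homeo_inv : X -> X;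
  homeo_continuous : continuous homeo_fun;
  homeo_inv_continuous : continuous homeo_inv;
  homeoK : cancel homeo_fun homeo_inv;
  homeoVK : cancel homeo_inv homeo_fun
}.

Lemma schwartz_comp_subproof (phi : homeomorphism) (f : schwartz) :
  (schwartz_val f \o phi) \in schwartz_pred.
Proof.
have /asboolP[lf cf] := schwartzP f; apply/asboolP; split.
  by move=> x; apply: (homeo_continuous (lf (phi x))).
set K := closure [set x | f x != 0] in cf.
have cK : compact (homeo_inv phi @` K).
  apply: continuous_compact => //; apply: continuous_subspaceT.
  exact: homeo_inv_continuous.
apply: (subclosed_compact (@closed_closure _ _) cK).
have -> : homeo_inv phi @` K = phi @^-1` K.
  apply/seteqP; split=> [_ [x Kx <-]|x Kx] /=; first by rewrite homeoVK.
  by exists (phi x); rewrite ?homeoK.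
have cl : closed (phi @^-1` K).
  apply: preimage_closed => [y _|]; first exact: homeo_continuous.
  exact: closed_closure.
rewrite [X in _ `<=` X](closure_id _).1 //; apply: closureS => x fx.
exact: subset_closure.
Qed.

Definition schwartz_comp f phi : schwartz :=
  Schwartz (schwartz_comp_subproof phi f).

Definition invariant_under (T : schwartz_distribution) (phi : homeomorphism) :=
  forall f : schwartz, T (schwartz_comp f phi) = T f.

End Schwartz.
Arguments homeomorphism : clear implicits.

Section FiniteDimensional.
Variables (R : realType) (F : nonArchLocalFieldType R).
Implicit Types V : vectType F.

(* The canonical topology of a finite-dimensional space, induced from F^n by
   the coordinates in a basis; since linear maps are continuous for it, it does
   not depend on the basis. *)
Definition vtop V :=
  initial_topology (rVof (vbasis {:V}) : V -> 'rV[F]_(\dim {:V})).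
HB.instance Definition _ V := Topological.on (vtop V).

Lemma absv0 : absv (0 : F) = 0.
Proof. by apply/eqP; rewrite absv_eq0. Qed.

Lemma absv_sum_lt (I : finType) (x : I -> F) (e : R) : 0 < e ->
  (forall i, absv (x i) < e) -> absv (\sum_i x i) < e.
Proof.
move=> e0 xe; elim/big_ind: _ => [|a b ae be|i _]; rewrite ?absv0 //.
by rewrite (le_lt_trans (absvD_max _ _)) // gt_max ae.
Qed.

Lemma mulmx_continuous m n (M : 'M[F]_(m, n)) :
  continuous (fun x : 'rV[F]_m => x *m M).
Proof.
move=> x A [P xP PA].
have /choice[d dP] (ij : 'I_1 * 'I_n) : exists d : R, 0 < d /\
    [set y | absv (y - (x *m M) ij.1 ij.2) < d] `<=` P ij.1 ij.2.
  by have /nbhs_absvE[d d0 dP] := xP ij.1 ij.2; exists d.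
pose e k j := d (0, j) / (1 + absv (M k j)).
have M0 k j : 0 < 1 + absv (M k j) by rewrite ltr_pwDl // absv_ge0.
have e0 k j : 0 < e k j by rewrite divr_gt0 //; have [] := dP (0, j).
exists (fun i k => [set y | forall j, absv (y - x i k) < e k j]) => [i k|y yx].
  have : \forall y \near x i k, forall j, absv (y - x i k) < e k j.
    by apply: filter_forall => j; apply/nbhs_absvE; exists (e k j).
  by [].
apply: PA => i j; have [d0 + ] := dP (i, j); apply; rewrite /= !mxE -sumrB.
apply: absv_sum_lt => // k; rewrite -mulrBl absvM.
have := yx i k j; rewrite /e (ord1 i) ltr_pdivlMr // => /(le_lt_trans _); apply.
by rewrite ler_wpM2l ?absv_ge0 // lerDr.
Qed.

Lemma linear_continuous_vtop V1 V2 (f : 'Hom(V1, V2)) :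
  continuous (f : vtop V1 -> vtop V2).
Proof.
apply: continuous_comp_initial => x.
have -> : rVof (vbasis {:V2}) \o f =
    (fun x => x *m mxof (vbasis {:V1}) (vbasis {:V2}) f) \o rVof (vbasis {:V1}).
  by apply/funext => y /=; rewrite (rVof_app _ (vbasisP _)).
apply: (@continuous_comp (vtop V1)); first exact: initial_continuous.
exact: mulmx_continuous.
Qed.

Lemma linear_continuous V1 V2 (f : V1 -> V2) :
  linear f -> continuous (f : vtop V1 -> vtop V2).
Proof.
move=> f_lin; pose fL := HB.pack_for {linear V1 -> V2} f
  (GRing.isLinear.Build F V1 V2 _ f f_lin).
have -> : f = linfun fL by apply/funext => x; rewrite lfunE.
exact: linear_continuous_vtop.
Qed.

Definition dual V := 'Hom(V, F^o).

Definition GL V := {g : 'End(V) | lker g == 0%VS}.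
HB.instance Definition _ V := SubType.on (GL V).
HB.instance Definition _ V := Choice.on (GL V).
HB.instance Definition _ V := Topological.copy (GL V)
  (initial_topology (fun g : GL V => val g : vtop 'End(V))).

Definition GLval V (g : GL V) : 'End(V) := val g.
Coercion GLval : GL >-> hom.

Lemma GL_eq V (g h : GL V) : g =1 h -> g = h.
Proof. by move=> gh; apply/val_inj/lfunP. Qed.

Lemma GL_inj V (g : GL V) : injective g.
Proof. exact/lker0P/(valP g). Qed.

Lemma GL_mul_subproof V (g h : GL V) : lker (g \o h)%VF == 0%VS.
Proof. by apply/lker0P => x y; rewrite !lfunE => /GL_inj/GL_inj. Qed.

Definition GLmul V (g h : GL V) : GL V := Sub (g \o h)%VF (GL_mul_subproof g h).

Lemma GL_inv_subproof V (g : GL V) : lker (g^-1)%VF == 0%VS.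
Proof. exact/lker0P/(can_inj (lker0_lfunVK (valP g))). Qed.

Definition GLinv V (g : GL V) : GL V := Sub (g^-1)%VF (GL_inv_subproof g).

Lemma GLmulE V (g h : GL V) v : GLmul g h v = g (h v).
Proof. exact: comp_lfunE. Qed.

Lemma GLK V (g : GL V) : cancel g (GLinv g).
Proof. exact/lker0_lfunK/(valP g). Qed.

Lemma GLVK V (g : GL V) : cancel (GLinv g) g.
Proof. exact/lker0_lfunVK/(valP g). Qed.

Lemma GLinvK V : involutive (@GLinv V).
Proof.
by move=> g; apply: GL_eq => v; apply: (GL_inj (g := GLinv g)); rewrite GLVK GLK.
Qed.

Definition GLconj V (g x : GL V) : GL V := GLmul (GLmul g x) (GLinv g).

Lemma GLconjK V (g : GL V) : cancel (GLconj g) (GLconj (GLinv g)).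
Proof. by move=> x; apply: GL_eq => v; rewrite !GLmulE GLinvK !GLK. Qed.

Lemma GLconjVK V (g : GL V) : cancel (GLconj (GLinv g)) (GLconj g).
Proof. by move=> x; rewrite -{1}(GLinvK g) GLconjK. Qed.

Lemma GL_continuous V (X : topologicalType) (p q : X -> GL V)
    (f : 'End(V) -> 'End(V)) : linear f ->
  (forall x, q x = f (p x) :> 'End(V)) -> continuous p -> continuous q.
Proof.
move=> f_lin qE pc; apply: continuous_comp_initial.
have -> : val \o q = f \o (val \o p) by apply/funext => x; exact: qE.
move=> x; apply: (@continuous_comp _ (vtop 'End(V)) (vtop 'End(V))).
  by apply: continuous_comp; [exact: pc | exact: initial_continuous].
exact: linear_continuous.
Qed.

Lemma GLconj_continuous V (X : topologicalType) (p : X -> GL V) (g : GL V) :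
  continuous p -> continuous (fun x => GLconj g (p x)).
Proof.
pose f (x : 'End(V)) : 'End(V) := ((g \o x) \o GLinv g)%VF.
have f_lin : linear f.
  by move=> a x y; rewrite /f comp_lfunDr comp_lfunDl comp_lfunZl comp_lfunZr.
exact: (GL_continuous f_lin).
Qed.

Definition GLconj_homeo V (g : GL V) : homeomorphism (GL V) :=
  Homeomorphism
    (GLconj_continuous (g := g) (fun x => cvg_id))
    (GLconj_continuous (g := GLinv g) (fun x => cvg_id))
    (GLconjK g) (GLconjVK g).

Definition triples V : topologicalType := (GL V * vtop V * vtop (dual V))%type.

Lemma continuous_compose (X Y Z : topologicalType) (f : X -> Y) (h : Y -> Z) :
  continuous f -> continuous h -> continuous (fun x => h (f x)).
Proof. by move=> fc hc x; exact: (continuous_comp (fc x) (hc (f x))). Qed.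

Lemma triple_fst_continuous V : continuous (fun p : triples V => p.1.1).
Proof. by move=> p; exact: (cvg_comp (G := nbhs p.1) _ _ cvg_fst cvg_fst). Qed.

Lemma triple_snd_continuous V : continuous (fun p : triples V => p.1.2).
Proof. by move=> p; exact: (cvg_comp (G := nbhs p.1) _ _ cvg_fst cvg_snd). Qed.

Lemma triple_thd_continuous V : continuous (fun p : triples V => p.2).
Proof. by move=> p; exact: cvg_snd. Qed.

Lemma triple_continuous V (X : topologicalType) (a : X -> GL V) (b : X -> vtop V)
    (c : X -> vtop (dual V)) : continuous a -> continuous b -> continuous c ->
  continuous (fun x => (a x, b x, c x) : triples V).
Proof.
by move=> ac bc cc x; exact: (cvg_pair (cvg_pair (ac x) (bc x)) (cc x)).
Qed.

(* g.(x, v, l) = (g x g^-1, g v, l o g^-1) *)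
Definition triple_act V (g : GL V) (p : triples V) : triples V :=
  (GLconj g p.1.1, g p.1.2, (p.2 \o GLinv g)%VF).

Lemma triple_actK V (g : GL V) : cancel (triple_act g) (triple_act (GLinv g)).
Proof.
move=> [[x v] l]; rewrite /triple_act /= GLconjK GLK; congr (_, _).
by apply/lfunP => w; rewrite !comp_lfunE GLinvK GLK.
Qed.

Lemma triple_act_continuous V (g : GL V) : continuous (triple_act g).
Proof.
have l_lin : linear (fun l : dual V => (l \o GLinv g)%VF).
  by move=> a x y; rewrite comp_lfunDl comp_lfunZl.
apply: (@triple_continuous V (triples V) (fun p => GLconj g p.1.1)
  (fun p => g p.1.2) (fun p => (p.2 \o GLinv g)%VF)).
- exact: (GLconj_continuous (g := g) (triple_fst_continuous (V := V))).
- exact: (continuous_compose (@triple_snd_continuous V)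
    (linear_continuous_vtop (f := g))).
- exact: (continuous_compose (@triple_thd_continuous V)
    (linear_continuous l_lin)).
Qed.

Lemma triple_actVK V (g : GL V) : cancel (triple_act (GLinv g)) (triple_act g).
Proof. by move=> p; rewrite -{1}(GLinvK g) triple_actK. Qed.

Definition triple_act_homeo V (g : GL V) : homeomorphism (triples V) :=
  Homeomorphism (triple_act_continuous (g := g))
    (triple_act_continuous (g := GLinv g)) (triple_actK g) (triple_actVK g).

Section Sigma.
Variables (V : vectType F) (e : (\dim {:V}).-tuple V).

(* The map u : V -> V^* sending e_i to the dual basis vector e_i^* = coord e i *)
Definition dual_basis_map : 'Hom(V, dual V) :=
  linfun (fun v => \sum_i coord e i v *: linfun (coord e i : V -> F^o)).
Local Notation u := dual_basis_map.

Lemma dual_basis_mapE v w : u v w = \sum_i coord e i v * coord e i w.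
Proof.
pose f (v : V) : dual V :=
  \sum_i coord e i v *: linfun (coord e i : V -> F^o).
have f_lin : linear f.
  move=> a x y; rewrite /f scaler_sumr -big_split /=; apply: eq_bigr => i _.
  by rewrite linearP scalerDl scalerA.
pose fL := HB.pack_for {linear V -> dual V} f
  (GRing.isLinear.Build F V (dual V) _ f f_lin).
rewrite /u -[fun v => _]/(f) (lfunE fL) /= /f sum_lfunE.
apply: eq_bigr => i _; rewrite scale_lfunE; congr (_ * _).
have c_lin : linear (coord e i : V -> F^o) by move=> a x y; rewrite linearP.
pose cL := HB.pack_for {linear V -> F^o} (coord e i : V -> F^o)
  (GRing.isLinear.Build F V F^o _ (coord e i : V -> F^o) c_lin).
by rewrite (lfunE cL).
Qed.

Lemma dual_basis_mapC v w : u v w = u w v.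
Proof. by rewrite !dual_basis_mapE; apply: eq_bigr => i _; rewrite mulrC. Qed.

Hypothesis he : basis_of {:V} e.

Lemma dual_basis_map_basis (i : 'I_(\dim {:V})) v : u v e`_i = coord e i v.
Proof.
rewrite dual_basis_mapE (bigD1 i) //= coord_free ?(basis_free he) // eqxx mulr1.
rewrite big1 ?addr0 // => j ji.
by rewrite coord_free ?(basis_free he) // eq_sym (negPf ji) mulr0.
Qed.

Lemma dual_basis_map_inj : injective u.
Proof.
move=> v w uvw.
rewrite (coord_basis he (memvf v)) (coord_basis he (memvf w)).
by apply: eq_bigr => i _; rewrite -!dual_basis_map_basis uvw.
Qed.

Lemma dual_basis_mapK : cancel u (u^-1)%VF.
Proof. exact/lker0_lfunK/lker0P/dual_basis_map_inj. Qed.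

Lemma dual_basis_mapVK : cancel (u^-1)%VF u.
Proof.
move=> l; suff [v ->] : exists v, l = u v by rewrite dual_basis_mapK.
exists (\sum_(i < \dim {:V}) l e`_i *: e`_i); apply/lfunP => w.
rewrite [in LHS](coord_basis he (memvf w)) linear_sum dual_basis_mapE.
apply: eq_bigr => i _; rewrite linearZ /= coord_sum_free ?(basis_free he) //.
exact: mulrC.
Qed.

Definition trlfun (x : 'End(V)) : 'End(dual V) :=
  linfun (fun l : dual V => (l \o x)%VF).

Lemma trlfunE x l v : trlfun x l v = l (x v).
Proof.
pose f (l : dual V) : dual V := (l \o x)%VF.
have f_lin : linear f by move=> a y z; rewrite /f comp_lfunDl comp_lfunZl.
pose fL := HB.pack_for {linear dual V -> dual V} f
  (GRing.isLinear.Build F (dual V) (dual V) _ f f_lin).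
by rewrite /trlfun -[fun l => _]/(f) (lfunE fL) /= comp_lfunE.
Qed.

Definition sigma_end (x : 'End(V)) : 'End(V) := (u^-1 \o (trlfun x \o u))%VF.

Lemma sigma_endE x v w : u (sigma_end x v) w = u v (x w).
Proof. by rewrite !comp_lfunE dual_basis_mapVK trlfunE. Qed.

Lemma sigma_endK : involutive sigma_end.
Proof.
move=> x; apply/lfunP => v; apply: dual_basis_map_inj; apply/lfunP => w.
by rewrite sigma_endE dual_basis_mapC sigma_endE dual_basis_mapC.
Qed.

Lemma sigma_end_linear : linear sigma_end.
Proof.
move=> a x y; apply/lfunP => v; apply: dual_basis_map_inj; apply/lfunP => w.
rewrite sigma_endE !add_lfunE !scale_lfunE (linearP u).
by rewrite add_lfunE scale_lfunE !sigma_endE linearD linearZ.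
Qed.

Lemma sigma_GL_subproof (x : GL V) : lker (sigma_end x) == 0%VS.
Proof.
apply/lker0P => v w svw; apply: dual_basis_map_inj; apply/lfunP => y.
by rewrite -(GLVK x y) -!sigma_endE svw.
Qed.

Definition sigma_GL (x : GL V) : GL V := Sub (sigma_end x) (sigma_GL_subproof x).

(* sigma(x, v, l) = (u^-1 x^T u, u^-1 l, u v) *)
Definition sigma (p : triples V) : triples V :=
  (sigma_GL p.1.1, (u^-1)%VF p.2, u p.1.2).

Lemma sigmaK : involutive sigma.
Proof.
move=> [[x v] l]; rewrite /sigma /= dual_basis_mapK dual_basis_mapVK.
by congr (_, _, _); apply: val_inj; exact: sigma_endK.
Qed.

Lemma sigma_continuous : continuous sigma.
Proof.
apply: (@triple_continuous V (triples V) (fun p => sigma_GL p.1.1)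
  (fun p => (u^-1)%VF p.2) (fun p => u p.1.2)).
- exact: (GL_continuous sigma_end_linear (q := fun p => sigma_GL p.1.1)
    (fun p => erefl) (@triple_fst_continuous V)).
- exact: (continuous_compose (@triple_thd_continuous V)
    (linear_continuous_vtop (f := (u^-1)%VF))).
- exact: (continuous_compose (@triple_snd_continuous V)
    (linear_continuous_vtop (f := u))).
Qed.

Definition sigma_homeo : homeomorphism (triples V) :=
  Homeomorphism sigma_continuous sigma_continuous sigmaK sigmaK.

End Sigma.

(* On invariant distributions, the action of sigma does not depend on the
   basis: two choices of sigma differ by the action of an element of GL(V). *)
Lemma sigma_basis_independent V (e e' : (\dim {:V}).-tuple V)
    (he : basis_of {:V} e) (he' : basis_of {:V} e')
    (T : schwartz_distribution R (triples V)) :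
  (forall g : GL V, invariant_under T (triple_act_homeo g)) ->
  invariant_under T (sigma_homeo he) -> invariant_under T (sigma_homeo he').
Proof.
move=> Tinv Tsigma f.
set u := dual_basis_map e; set u' := dual_basis_map e'.
have g_inj : lker (u'^-1 \o u)%VF == 0%VS.
  apply/lker0P => v w; rewrite !comp_lfunE.
  by move=> /(can_inj (dual_basis_mapVK he'))/(dual_basis_map_inj he).
pose g : GL V := Sub (u'^-1 \o u)%VF g_inj.
have u'g v : u' (g v) = u v by rewrite comp_lfunE (dual_basis_mapVK he').
have ug v w : u v (GLinv g w) = u' v w.
  by rewrite /u dual_basis_mapC -/u -u'g GLVK /u' dual_basis_mapC.
have sigmaE p : sigma he' p = triple_act g (sigma he p).
  rewrite /triple_act /sigma /=; congr (_, _, _).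
  - apply: GL_eq => v; rewrite !GLmulE; apply: (dual_basis_map_inj he').
    apply/lfunP => w; rewrite (sigma_endE he') u'g (sigma_endE he).
    by rewrite dual_basis_mapC -/u' -ug /u dual_basis_mapC.
  - by rewrite comp_lfunE dual_basis_mapVK.
  - by apply/lfunP => w; rewrite comp_lfunE ug.
rewrite -[RHS](Tinv g) -[RHS]Tsigma; congr (T _).
by apply/val_inj/funext => p; rewrite /= sigmaE.
Qed.

Section Transposition.
Variables (W : vectType F) (b : (\dim {:W}).-tuple W).

(* Row-vector convention for [mxof]; transposition is insensitive to it. *)
Definition transpose_end (x : 'End(W)) : 'End(W) := hommx b b (mxof b b x)^T.

Lemma transpose_end_linear : linear transpose_end.
Proof. by move=> a x y; rewrite /transpose_end !linearP. Qed.

Hypothesis hb : basis_of {:W} b.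

Lemma transpose_endK : involutive transpose_end.
Proof.
by move=> x; rewrite /transpose_end hommxK // trmxK mxofK.
Qed.

Lemma transpose_GL_subproof (x : GL W) : lker (transpose_end x) == 0%VS.
Proof.
apply/lker0P; apply: (can_inj (g := transpose_end (GLinv x))) => v.
suff : (transpose_end (GLinv x) \o transpose_end x)%VF = \1%VF.
  by move=> /lfunP/(_ v); rewrite comp_lfunE id_lfunE.
have xV : (x \o GLinv x)%VF = \1%VF.
  by apply/lfunP => w; rewrite comp_lfunE id_lfunE GLVK.
rewrite -hommx_mul // -trmx_mul -mxof_comp // xV.
by rewrite mxof1 ?(basis_free hb) // trmx1 hommx1.
Qed.

Definition transpose_GL (x : GL W) : GL W :=
  Sub (transpose_end x) (transpose_GL_subproof x).

Lemma transpose_GLK : involutive transpose_GL.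
Proof. by move=> x; apply: val_inj; exact: transpose_endK. Qed.

Lemma transpose_GL_continuous : continuous transpose_GL.
Proof.
exact: (GL_continuous transpose_end_linear (p := id) (q := transpose_GL)
  (fun x => erefl) (fun x => cvg_id)).
Qed.

Definition transpose_homeo : homeomorphism (GL W) :=
  Homeomorphism transpose_GL_continuous transpose_GL_continuous
    transpose_GLK transpose_GLK.

End Transposition.

Section Embedding.
Variables (W : vectType F) (V U : {vspace W}).

(* The endomorphism of W = V + U equal to x on V and to the identity on U. *)
Definition extend_end (x : 'End(subvs_of V)) : 'End(W) :=
  (linfun vsval \o x \o linfun (vsproj V) \o daddv_pi V U + daddv_pi U V)%VF.

Hypotheses (VU1 : (V + U)%VS = fullv) (VU0 : (V :&: U)%VS = 0%VS).

Lemma extend_endE x w :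
  extend_end x w = vsval (x (vsproj V (daddv_pi V U w))) + daddv_pi U V w.
Proof. by rewrite add_lfunE !comp_lfunE !lfunE. Qed.

Lemma extend_end_left x v : extend_end x (vsval v) = vsval (x v).
Proof.
have vV := subvsP v.
have vU0 : daddv_pi U V (vsval v) = 0.
  have := daddv_pi_add VU0 (w := vsval v); rewrite VU1 memvf => /(_ isT).
  by rewrite daddv_pi_id // -[X in _ = X]addr0 => /addrI.
by rewrite extend_endE vU0 addr0 daddv_pi_id // vsvalK.
Qed.

Lemma extend_end_right x w : w \in U -> extend_end x w = w.
Proof.
have UV0 : (U :&: V = 0)%VS by rewrite capvC.
move=> wU; have vV0 : daddv_pi V U w = 0.
  have := daddv_pi_add VU0 (w := w); rewrite VU1 memvf => /(_ isT).
  by rewrite (daddv_pi_id UV0) // -[X in _ = X]add0r => /addIr.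
by rewrite extend_endE vV0 !linear0 add0r daddv_pi_id.
Qed.

Lemma extend_end_GL_subproof (g : GL (subvs_of V)) :
  lker (extend_end g) == 0%VS.
Proof.
apply/lker0P; apply: (can_inj (g := extend_end (GLinv g))) => w.
have := daddv_pi_add VU0 (w := w); rewrite VU1 memvf => /(_ isT) <-.
have /vsprojK <- := memv_pi V U w; have piU := memv_pi U V w.
by rewrite !linearD /= !extend_end_left !extend_end_right // GLK.
Qed.

Definition GLextend (g : GL (subvs_of V)) : GL W :=
  Sub (extend_end g) (extend_end_GL_subproof g).

Definition adapted_basis (b : seq W) :=
  exists (e : seq W) (u : W),
    [/\ basis_of V e, u \in U, u != 0 & b = rcons e u].

End Embedding.

End FiniteDimensional.

(* Main.v *)
From HB Require Import structures.
Require Import Defs.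
From mathcomp Require Import all_boot all_order all_algebra.
From mathcomp Require Import complex finmap.
From mathcomp Require Import all_classical all_reals all_analysis.

(* Frobenius descent.  Let u span U and let u^* be the linear form equal to 1
   at u and vanishing on V; the stabilizer of (u, u^* ) in GL(W) is GL(V).  A
   GL(V)-invariant distribution T on GL(W) therefore spreads along the orbit
   of (u, u^* ): the value F(w, l) of T on x |-> f(g x g^-1, w, l) does not
   depend on the choice of g carrying the lines of (u, u^* ) to those of
   (w, l), because scalars act trivially by conjugation as well.  Taking all
   (w, l) with |l(w)| = 1, rather than l(w) = 1, gives an open set, so that F
   can be integrated against the Haar measure of W x W^*, which is invariant
   under GL(W) since the moduli of g and of its contragredient cancel.  The
   result is a GL(W)-invariant distribution on GL(W) x W x W^*, and hence a
   sigma-invariant one by the hypothesis for W.  Near (u, u^* ) the function F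
   attached to phi times the indicator of a small ball is T(phi) times that
   indicator; sigma fixes the ball and transposes phi, so
   T(phi) = T(phi^t). *)

Set Implicit Arguments.
Unset Strict Implicit.
Unset Printing Implicit Defensive.

Import Order.TTheory GRing.Theory Num.Theory numFieldNormedType.Exports passmx.

Local Open Scope classical_set_scope.
Local Open Scope ring_scope.

(** * Ultrametric norms *)

Section AbsoluteValue.
Variables (R : realType) (F : nonArchLocalFieldType R).
Implicit Types x y : F.

Lemma absv_gt0 x : (0 < absv x) = (x != 0).
Proof. by rewrite lt_def absv_ge0 absv_eq0 andbT. Qed.

Lemma absv1 : absv (1 : F) = 1.
Proof.
have n0 : absv (1 : F) != 0 by rewrite absv_eq0 oner_eq0.
by apply: (mulfI n0); rewrite -absvM !mulr1.
Qed.

Lemma absvN x : absv (- x) = absv x.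
Proof.
have : absv (-1 : F) = 1.
  apply/eqP; rewrite -(@pexpr_eq1 _ _ 2%N) ?absv_ge0 //.
  by rewrite expr2 -absvM mulrNN mulr1 absv1.
by move=> e; rewrite -mulN1r absvM e mul1r.
Qed.

Lemma absvB x y : absv (x - y) = absv (y - x).
Proof. by rewrite -absvN opprB. Qed.

Lemma absvV x : absv x^-1 = (absv x)^-1.
Proof.
have [->|x0] := eqVneq x 0; first by rewrite invr0 absv0 invr0.
have n0 : absv x != 0 by rewrite absv_eq0.
by apply: (mulfI n0); rewrite -absvM !divff // absv1.
Qed.

Lemma absvX x n : absv (x ^+ n) = absv x ^+ n.
Proof. by elim: n => [|n IH]; rewrite ?expr0 ?absv1 // !exprS absvM IH. Qed.

Lemma absv_sum_le (I : finType) (f : I -> F) (s : R) : 0 <= s ->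
  (forall i, absv (f i) <= s) -> absv (\sum_i f i) <= s.
Proof.
move=> s0 fs; elim/big_ind: _ => [|a b ha hb|i _]; rewrite ?absv0 //.
by rewrite (le_trans (absvD_max _ _)) // ge_max ha.
Qed.

(** If [y] were strictly smaller than [x], then so would be [(x - y) + y], which is [x]; the other
    inequality is the ultrametric one. *)
Lemma absv_near x y : absv (y - x) < absv x -> absv y = absv x.
Proof.
move=> h; apply/eqP; rewrite eq_le; apply/andP; split.
  by rewrite -(subrK x y) (le_trans (absvD_max _ _)) // ge_max (ltW h) lexx.
rewrite leNgt; apply/negP => yx; have := absvD_max (x - y) y.
by rewrite subrK absvB leNgt gt_max h yx.
Qed.

Lemma exists_small (r : R) : 0 < r -> exists2 x : F, x != 0 & absv x < r.
Proof.
move=> r0.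
(* Nontriviality only gives an absolute value other than 1; inverting the element if needed makes it
   less than 1, and its powers then tend to 0. *)
have [p p0 p1] : exists2 p : F, p != 0 & absv p < 1.
  have [x x0 x1] := @absv_nontrivial R F.
  have := real_ltgtP (num_real (absv x)) (num_real 1).
  case=> [lt|gt|e]; [by exists x| |by rewrite e eqxx in x1].
  by exists x^-1; rewrite ?invr_neq0 // absvV invf_lt1 // absv_gt0.
have p1' : `|absv p| < 1 by rewrite ger0_norm ?absv_ge0.
have /cvgrPdist_lt/(_ _ r0)[n _ /(_ n (leqnn n))] := cvg_expr p1'.
rewrite /= sub0r normrN ger0_norm.
  by move=> h; exists (p ^+ n); rewrite ?expf_neq0 // absvX.
by rewrite exprn_ge0 ?absv_ge0.
Qed.

Lemma exists_large (s : R) : exists2 x : F, x != 0 & s < absv x.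
Proof.
have s1 : 0 < (1 + `|s|)^-1 by rewrite invr_gt0 ltr_pwDl.
have [x x0 xs] := exists_small s1; exists x^-1; rewrite ?invr_neq0 // absvV.
rewrite (@lt_le_trans _ _ (1 + `|s|)) //.
  by rewrite (le_lt_trans (ler_norm s)) // ltrDr.
by rewrite -[X in X <= _]invrK lef_pV2 ?posrE ?absv_gt0 // ltW.
Qed.

End AbsoluteValue.

Section MatrixNorm.
Variables (R : realType) (F : nonArchLocalFieldType R).

Definition mxabs m n (A : 'M[F]_(m, n)) : R :=
  \big[Num.max/0]_ij absv (A ij.1 ij.2).

Section Fixed.
Variables m n : nat.
Implicit Types A B : 'M[F]_(m, n).

Lemma mxabs_ge0 A : 0 <= mxabs A.
Proof.
rewrite /mxabs; elim/big_ind: _ => // [x y x0 y0|ij _].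
  by rewrite le_max x0.
exact: absv_ge0.
Qed.

Lemma mxabs_leP A (s : R) : 0 <= s ->
  (mxabs A <= s) <-> (forall i j, absv (A i j) <= s).
Proof.
move=> s0; split=> [/bigmax_leP[_ h] i j|h]; first exact: (h (i, j)).
by apply/bigmax_leP; split=> // ij _; exact: h.
Qed.

Lemma mxabs_ltP A (r : R) : 0 < r ->
  (mxabs A < r) <-> (forall i j, absv (A i j) < r).
Proof.
move=> r0; split=> [/bigmax_ltP[_ h] i j|h]; first exact: (h (i, j)).
by apply/bigmax_ltP; split=> // ij _; exact: h.
Qed.

Lemma absv_le_mxabs A i j : absv (A i j) <= mxabs A.
Proof. exact: (le_bigmax _ (fun ij => absv (A ij.1 ij.2)) (i, j)). Qed.

Lemma mxabs0 : mxabs (0 : 'M[F]_(m, n)) = 0.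
Proof.
apply/eqP; rewrite eq_le mxabs_ge0 andbT; apply/mxabs_leP => // i j.
by rewrite mxE absv0.
Qed.

Lemma mxabsD A B : mxabs (A + B) <= Num.max (mxabs A) (mxabs B).
Proof.
apply/mxabs_leP => [|i j]; first by rewrite le_max mxabs_ge0.
by rewrite mxE (le_trans (absvD_max _ _)) // ge_max !le_max !absv_le_mxabs orbT.
Qed.

Lemma mxabsZ a A : mxabs (a *: A) = absv a * mxabs A.
Proof.
rewrite /mxabs (eq_bigr (fun ij => absv a * absv (A ij.1 ij.2))); last first.
  by move=> ij _; rewrite mxE absvM.
elim/big_ind2: _ => [|x1 x2 y1 y2 -> ->|//]; first by rewrite mulr0.
by rewrite maxr_pMr ?absv_ge0.
Qed.

Lemma mxabsN A : mxabs (- A) = mxabs A.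
Proof. by rewrite -scaleN1r mxabsZ absvN absv1 mul1r. Qed.

Lemma mxabsB A B : mxabs (A - B) = mxabs (B - A).
Proof. by rewrite -mxabsN opprB. Qed.

Lemma mxabsD_lt A B (r : R) : mxabs A < r -> mxabs B < r -> mxabs (A + B) < r.
Proof. by move=> ha hb; rewrite (le_lt_trans (mxabsD _ _)) // gt_max ha. Qed.

Lemma mxabsD_le A B (r : R) : mxabs A <= r -> mxabs B <= r -> mxabs (A + B) <= r.
Proof. by move=> ha hb; rewrite (le_trans (mxabsD _ _)) // ge_max ha. Qed.

Lemma mxabsBD_lt A B (r : R) : mxabs (A - B) < r -> (mxabs A < r) = (mxabs B < r).
Proof.
move=> h; apply/idP/idP => ?; last by rewrite -(subrK B A) mxabsD_lt.
by rewrite -(subrK A B) mxabsD_lt // mxabsB.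
Qed.

End Fixed.

Lemma mxabs_tr m n (A : 'M[F]_(m, n)) : mxabs A^T = mxabs A.
Proof.
apply/eqP; rewrite eq_le; apply/andP.
by split; apply/mxabs_leP; rewrite ?mxabs_ge0 // => i j;
  [rewrite mxE absv_le_mxabs | have := absv_le_mxabs A^T j i; rewrite mxE].
Qed.

Lemma mxabsM m n p (A : 'M[F]_(m, n)) (B : 'M[F]_(n, p)) :
  mxabs (A *m B) <= mxabs A * mxabs B.
Proof.
have AB0 : 0 <= mxabs A * mxabs B by rewrite mulr_ge0 ?mxabs_ge0.
apply/mxabs_leP => // i j; rewrite mxE; apply: absv_sum_le => // k.
by rewrite absvM ler_pM ?absv_ge0 ?absv_le_mxabs.
Qed.

Lemma mxabs_row_mx p m n (A : 'M[F]_(p, m)) (B : 'M[F]_(p, n)) (r : R) :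
  (mxabs (row_mx A B) < r) = (mxabs A < r) && (mxabs B < r).
Proof.
have [r0|r0] := ltP 0 r; last first.
  by rewrite !ltNge !(le_trans r0) // mxabs_ge0.
apply/idP/andP=> [/(mxabs_ltP _ r0) h|[/(mxabs_ltP _ r0) ha /(mxabs_ltP _ r0) hb]].
  split; apply/mxabs_ltP => // i j.
    by have := h i (lshift n j); rewrite row_mxEl.
  by have := h i (rshift m j); rewrite row_mxEr.
apply/mxabs_ltP => // i j; rewrite -(splitK j).
by case: (fintype.split j) => k /=; rewrite ?row_mxEl ?row_mxEr; [exact: ha|exact: hb].
Qed.

End MatrixNorm.

(** * Compactness of closed balls in the field and its powers *)

Section Compactness.
Variables (R : realType) (F : nonArchLocalFieldType R).

(** Local compactness gives a compact neighbourhood of 0, which contains a ball. Dilating it by an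
    element [a] of large absolute value makes it cover the given closed ball, a closed subset of the
    compact image. *)
Lemma compact_absv_le (s : R) : compact [set x : F | absv x <= s].
Proof.
have nb (x : F) (r : R) : 0 < r -> nbhs x [set y | absv (y - x) < r].
  by move=> r0; apply/nbhs_absvE; exists r.
have [C C0 [cC _]] : exists2 C : set F, nbhs 0 C & compact C /\ closed C.
  have [C] := @locally_compact_absv R F 0 I.
  by rewrite withinET => C0 [? ?]; exists C.
have [e e0 eC] := (nbhs_absvE 0 C).1 C0.
have [a a0 as_] := exists_large F (s / e).
have cl : closed [set x : F | absv x <= s].
  move=> x clx; rewrite /= leNgt; apply/negP => sx.
  have x0 : 0 < absv x.
    have [y [/= ys _]] := clx _ (nb x 1 ltr01).
    by rewrite (le_lt_trans _ sx) // (le_trans (absv_ge0 y)).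
  have [y [/= ys /absv_near yx]] := clx _ (nb x _ x0).
  by move: sx; rewrite -yx ltNge ys.
have mc : continuous (fun x : F => a * x).
  move=> x A /nbhs_absvE[r r0 rA]; apply/nbhs_absvE.
  exists (r / absv a); first by rewrite divr_gt0 ?absv_gt0.
  move=> y /= yx; apply: rA; rewrite /= -mulrBr absvM mulrC.
  by rewrite -ltr_pdivlMr ?absv_gt0.
apply: (subclosed_compact cl (continuous_compact (continuous_subspaceT mc) cC)).
move=> x /= xs; exists (a^-1 * x); last by rewrite mulVKf.
apply: eC; rewrite /= subr0 absvM absvV ltr_pdivrMl ?absv_gt0 //.
by rewrite (le_lt_trans xs) // -ltr_pdivrMr.
Qed.

Lemma nbhs_mxabs n (x : 'rV[F]_n) (A : set 'rV[F]_n) :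
  nbhs x A <-> exists2 e : R, 0 < e & [set y | mxabs (y - x) < e] `<=` A.
Proof.
split=> [[P xP PA]|[e e0 eA]].
  have /choice[d dP] (j : 'I_n) : exists d : R, 0 < d /\
      [set y | absv (y - x 0 j) < d] `<=` P 0 j.
    by have /nbhs_absvE[d d0 dP] := xP 0 j; exists d.
  exists (\big[Num.min/1]_j d j).
    by elim/big_ind: _ => // [a b a0 b0|j _]; [rewrite lt_min a0|exact: (dP j).1].
  move=> y /= yx; apply: PA => i j; rewrite (ord1 i); apply: (dP j).2 => /=.
  have := absv_le_mxabs (y - x) 0 j; rewrite !mxE => /le_lt_trans; apply.
  by rewrite (lt_le_trans yx) // bigmin_le_cond.
exists (fun i j => [set y | absv (y - x i j) < e]) => [i j|y yx].
  by apply/nbhs_absvE; exists e.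
by apply: eA; apply/mxabs_ltP => // i j; rewrite !mxE; exact: yx.
Qed.

Lemma compact_mxabs_le n (s : R) : compact [set x : 'rV[F]_n | mxabs x <= s].
Proof.
have [s0|s0] := ltP s 0.
  rewrite (_ : [set _ | _] = set0); first exact: compact0.
  by apply/seteqP; split=> x //= /le_lt_trans/(_ s0); rewrite ltNge mxabs_ge0.
pose PF : ptopologicalType := HB.pack_for ptopologicalType F (isPointed.Build F 0).
have := @rV_compact PF n (fun=> [set x : F | absv x <= s])
  (fun _ => @compact_absv_le s).
rewrite (_ : [set v | _] = [set x : 'rV[F]_n | mxabs x <= s]) //.
apply/seteqP; split=> x /=.
  by move=> h; apply/mxabs_leP => // i j; rewrite (ord1 i); exact: h.
by move=> /(mxabs_leP _ s0) h j; exact: h.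
Qed.

Lemma mxabs_totally_bounded n (r s : R) : 0 < r -> exists l : seq 'rV[F]_n,
  forall x : 'rV[F]_n, mxabs x <= s -> exists2 y, y \in l & mxabs (x - y) < r.
Proof.
(* [E], below, is the filter of sufficiently large finite lists, ordered by inclusion. Each point
   covers its own neighbourhood, and compactness in near-covering form merges these centres into one
   list. *)
move=> r0; pose G (l0 : seq 'rV[F]_n) := [set l : seq _ | {subset l0 <= l}].
pose E := filter_from setT G.
have FE : Filter E.
  apply: filter_from_filter; first by exists [::].
  move=> l1 l2 _ _; exists (l1 ++ l2) => // l h.
  by split=> x xl; apply: h; rewrite mem_cat xl ?orbT.
have /compact_near_coveringP cs := @compact_mxabs_le n s.
have [x _|l _ h] := cs _ E (fun l x => exists2 y, y \in l & mxabs (x - y) < r) FE.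
  exists ([set x' | mxabs (x' - x) < r], [set l : seq _ | x \in l]) => /=.
    split; first by apply/nbhs_mxabs; exists r.
    by exists [:: x] => // l; apply; rewrite inE.
  by move=> [x' l] /= [x'x xl]; exists x.
by exists l => x xs; apply: (h l).
Qed.

End Compactness.

(** * Haar measure by summation over cosets *)

Section CosetSum.
Variables (R : realType) (F : nonArchLocalFieldType R) (K : numFieldType).
Variable N : nat.
Local Notation E := 'rV[F]_N.
Implicit Types (r s : R) (f g : E -> K) (x y c h : E).

(** For positive [r] these are Schwartz functions with an explicit period: the ball of radius [r]
    about 0 is a subgroup, and bounded sets are relatively compact. *)
Definition test_function r f :=
  (forall x y, mxabs (x - y) < r -> f x = f y) /\
  (exists s, forall x, f x != 0 -> mxabs x < s).

Definition ball_ind r x : K := (mxabs x < r)%R%:R.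

(** The choice depends on the ball only as a set, and ultrametric balls of one radius that meet
    coincide, so all points of a coset get the same representative. *)
Definition coset_rep r x : E := xget 0 [set y | mxabs (y - x) < r].

Definition coset_reps r : set E := [set c | coset_rep r c = c].

(** On functions of period [r], this is integration for the Haar measure giving mass 1 to each ball
    of radius [r]. *)
Definition coset_sum r f : K := \sum_(c \in coset_reps r) f c.

Lemma mxabs_subr_lt r x y z : mxabs (x - y) < r ->
  (mxabs (z - x) < r) = (mxabs (z - y) < r).
Proof.
by move=> xy; apply: mxabsBD_lt; rewrite opprB addrC addrA subrK mxabsB.
Qed.

Lemma coset_repP r x : 0 < r -> mxabs (coset_rep r x - x) < r.
Proof.
move=> r0; apply: (xgetPex 0 (P := [set y | mxabs (y - x) < r])).
by exists x; rewrite /= subrr mxabs0.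
Qed.

Lemma coset_rep_eq r x y : mxabs (x - y) < r -> coset_rep r x = coset_rep r y.
Proof.
move=> xy; congr (xget 0 _); apply/seteqP.
by split=> z /=; rewrite (mxabs_subr_lt z xy).
Qed.

Lemma coset_rep_reps r x : 0 < r -> coset_reps r (coset_rep r x).
Proof. by move=> r0; apply/coset_rep_eq/coset_repP. Qed.

Lemma coset_reps_inj r c x : coset_reps r c -> mxabs (x - c) < r ->
  c = coset_rep r x.
Proof. by move=> cr /coset_rep_eq ->. Qed.

Lemma finite_coset_reps r s : 0 < r ->
  finite_set (coset_reps r `&` [set x | mxabs x < s]).
Proof.
move=> r0; have [l lP] := @mxabs_totally_bounded _ F N r s r0.
apply: (@sub_finite_set _ _ (coset_rep r @` [set` l])); last first.
  exact/finite_image/finite_seq.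
move=> c [cr /ltW/lP[y yl cy]]; exists y => //.
by rewrite (coset_reps_inj cr (x := y)) // mxabsB.
Qed.

Lemma coset_sum_seq r s f : 0 < r -> (forall x, f x != 0 -> mxabs x < s) ->
  coset_sum r f = \sum_(c <- fset_set (coset_reps r `&` [set x | mxabs x < s])) f c.
Proof.
move=> r0 fs; rewrite -fsbig_finite; last exact: finite_coset_reps.
apply/esym/fsbig_widen; first exact: subIsetl.
move=> x [xr nx] /=; apply/eqP; apply: contrapT => /negP fx.
by apply: nx; split=> //; exact: fs.
Qed.

Lemma test_ball r : 0 < r -> test_function r (ball_ind r).
Proof.
move=> r0; split=> [x y xy|].
  by congr (_%:R); congr (nat_of_bool _); rewrite (mxabsBD_lt xy).
by exists r => x; rewrite /ball_ind; case: (mxabs x < r); rewrite ?eqxx.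
Qed.

Lemma test_le r r' f : r' <= r -> test_function r f -> test_function r' f.
Proof. by move=> rr [pf bf]; split=> // x y xy; apply: pf; exact: lt_le_trans rr. Qed.

Lemma test_linear r a f g : test_function r f -> test_function r g ->
  test_function r (fun x => a * f x + g x).
Proof.
move=> [pf [s fs]] [pg [t gt]]; split=> [x y xy|].
  by rewrite (pf _ _ xy) (pg _ _ xy).
exists (Num.max s t) => x; rewrite lt_max.
case: (eqVneq (f x) 0) => [->|/fs -> //]; case: (eqVneq (g x) 0) => [->|/gt -> _].
  by rewrite mulr0 addr0 eqxx.
by rewrite orbT.
Qed.

Lemma test_translate r h f : test_function r f ->
  test_function r (fun x => f (x + h)).
Proof.
move=> [pf [s fs]]; split=> [x y xy|].
  by apply: pf; rewrite opprD addrACA subrr addr0.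
exists (Num.max s (mxabs h + 1)) => x /fs xh.
rewrite -(addrK h x) mxabsD_lt // ?mxabsN lt_max ?xh // orbC.
by rewrite ltrDl ltr01.
Qed.

Lemma coset_sum_linear r a f g : 0 < r ->
    test_function r f -> test_function r g ->
  coset_sum r (fun x => a * f x + g x) = a * coset_sum r f + coset_sum r g.
Proof.
move=> r0 tf tg; have [_ [u us]] := test_linear a tf tg.
case: tf tg => [_ [s fs]] [_ [t gt]].
have le (v : R) : v <= Num.max u (Num.max s t) -> forall k : E -> K,
    (forall x, k x != 0 -> mxabs x < v) ->
    forall x, k x != 0 -> mxabs x < Num.max u (Num.max s t).
  by move=> le k kv x /kv h; exact: lt_le_trans le.
rewrite !(@coset_sum_seq r (Num.max u (Num.max s t))) //.
- by rewrite big_split /= mulr_sumr.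
- by apply: (le t) => //; rewrite !le_max lexx !orbT.
- by apply: (le s) => //; rewrite !le_max lexx !orbT.
- by apply: (le u) => //; rewrite !le_max lexx.
Qed.

(** Translation by [h] permutes the cosets, so [c |-> coset_rep r (c + h)] is a bijection of the
    representatives, and [f] does not distinguish [c + h] from its representative. *)
Lemma coset_sum_translate r h f : 0 < r -> test_function r f ->
  coset_sum r (fun x => f (x + h)) = coset_sum r f.
Proof.
move=> r0 [pf _]; pose t c := coset_rep r (c + h).
have bt : set_bij (coset_reps r) (coset_reps r) t.
  split=> [c _|c d|c cr]; first exact: coset_rep_reps.
    move=> /set_mem cr /set_mem dr e; have := coset_repP (c + h) r0.
    have := coset_repP (d + h) r0; rewrite -/(t c) -/(t d) e => td tc.
    have cd : mxabs (c - d) < r.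
      have -> : c - d = (t d - (d + h)) - (t d - (c + h)).
        by rewrite opprB [RHS]addrC addrA subrK opprD addrACA subrr addr0.
      by rewrite mxabsD_lt // mxabsN.
    by rewrite (coset_reps_inj dr cd) cr.
  exists (coset_rep r (c - h)); first exact: coset_rep_reps.
  rewrite /t -[RHS]cr; apply: coset_rep_eq.
  by have := coset_repP (c - h) r0; rewrite opprB addrA.
rewrite /coset_sum [RHS](reindex_fsbig _ _ _ _ bt); apply: eq_fsbigr => c _.
by apply/esym/pf; rewrite /t; exact: coset_repP.
Qed.

Lemma test_function_expand r f : 0 < r -> test_function r f ->
  exists2 X : seq E, f = (fun x => \sum_(c <- X) f c * ball_ind r (x - c)) &
    coset_sum r f = \sum_(c <- X) f c.
Proof.
move=> r0 [pf [s fs]]; exists (fset_set (coset_reps r `&` [set x | mxabs x < s])).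
  apply/funext => x; set X := fset_set _.
  have XP c : (c \in X) = (c \in coset_reps r `&` [set x | mxabs x < s]).
    by rewrite in_fset_set //; exact: finite_coset_reps.
  have [fx0|/[dup] /fs xs fx0] := eqVneq (f x) 0.
    rewrite fx0 big1_seq // => c /= _; rewrite /ball_ind.
    case: (ltP (mxabs (x - c)) r) => [/pf xc|_]; last by rewrite mulr0.
    by rewrite -xc fx0 mul0r.
  have fr : f (coset_rep r x) = f x by apply/pf/coset_repP.
  rewrite (bigD1_seq (coset_rep r x)) ?fset_uniq //=; last first.
    rewrite XP inE; split; first exact: coset_rep_reps.
    by apply: fs; rewrite fr.
  rewrite /ball_ind mxabsB coset_repP // mulr1 fr big1_seq ?addr0 // => c.
  rewrite XP => /andP[cx /set_mem[cr _]].
  case: (ltP (mxabs (x - c)) r) => [xc|_]; last by rewrite mulr0.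
  by rewrite (coset_reps_inj cr xc) eqxx in cx.
exact: coset_sum_seq.
Qed.

(* Uniqueness of Haar measure, at the level of the functions with period r. *)
Lemma coset_sum_unique r (J : (E -> K) -> K) : 0 < r ->
    (forall a f g, test_function r f -> test_function r g ->
      J (fun x => a * f x + g x) = a * J f + J g) ->
    (forall h f, test_function r f -> J (fun x => f (x + h)) = J f) ->
  forall f, test_function r f -> J f = coset_sum r f * J (ball_ind r).
Proof.
move=> r0 Jlin Jtr f tf; have [X fE ->] := test_function_expand r0 tf.
rewrite {1}fE; elim: X (f) {tf fE} => [|c X IH] {}f.
  have t0 : test_function r (fun=> 0 : K).
    by split=> //; exists 0 => x; rewrite eqxx.
  rewrite big_nil mul0r; transitivity (J (fun=> -1 * 0 + 0)).
    by congr J; apply/funext => x; rewrite big_nil mulr0 addr0.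
  by rewrite (Jlin _ _ _ t0 t0) mulN1r addNr.
have tb d : test_function r (fun x => ball_ind r (x - d)).
  exact/test_translate/test_ball.
have tX : test_function r (fun x => \sum_(d <- X) f d * ball_ind r (x - d)).
  elim: X {IH} => [|d X [p b]].
    split=> [x y _|]; first by rewrite !big_nil.
    by exists 0 => x; rewrite big_nil eqxx.
  have -> : (fun x => \sum_(e <- d :: X) f e * ball_ind r (x - e)) =
      (fun x => f d * ball_ind r (x - d) + \sum_(e <- X) f e * ball_ind r (x - e)).
    by apply/funext => x; rewrite big_cons.
  exact: test_linear.
rewrite big_cons mulrDl -IH.
rewrite -[J (ball_ind r)](Jtr (- c) _ (test_ball r0)) -Jlin //.
by congr J; apply/funext => x; rewrite big_cons.
Qed.

(** The sum counts representatives in the unit ball; that of the coset of 0 is one of them because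
    [r <= 1], and [K] has characteristic 0. *)
Lemma coset_sum_ball1_neq0 r : 0 < r -> r <= 1 -> coset_sum r (ball_ind 1) != 0.
Proof.
move=> r0 r1; rewrite (@coset_sum_seq r 1) //; last first.
  by move=> x; rewrite /ball_ind; case: (mxabs x < 1); rewrite ?eqxx.
set X := fset_set _.
have XP c : (c \in X) = (c \in coset_reps r `&` [set x | mxabs x < 1]).
  by rewrite in_fset_set //; exact: finite_coset_reps.
rewrite (eq_big_seq (fun=> 1%:R)); last first.
  by move=> c; rewrite XP inE => -[_ /= c1]; rewrite /ball_ind c1.
rewrite -natr_sum pnatr_eq0 sum_nat_seq_eq0 -has_predC.
apply/hasP; exists (coset_rep r 0) => //; rewrite XP inE; split.
  exact: coset_rep_reps.
by have := coset_repP 0 r0; rewrite subr0 /= => /lt_le_trans; apply.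
Qed.

(** On functions of period [r], the finer sum is also linear and translation invariant, hence a
    multiple of the coarser one; the multiple cancels in the quotient. *)
Lemma coset_sum_refine r r' f : 0 < r' -> r' <= r -> r <= 1 ->
    test_function r f ->
  coset_sum r' f / coset_sum r' (ball_ind 1) =
  coset_sum r f / coset_sum r (ball_ind 1).
Proof.
move=> r'0 r'r r1 tf; have r0 : 0 < r := lt_le_trans r'0 r'r.
have uniq g : test_function r g ->
    coset_sum r' g = coset_sum r g * coset_sum r' (ball_ind r).
  move: g; apply: coset_sum_unique => // [a g h tg th|h g tg].
    by apply: coset_sum_linear => //; exact: test_le r'r _.
  by apply: coset_sum_translate => //; exact: test_le r'r _.
have := coset_sum_ball1_neq0 r'0 (le_trans r'r r1).
have t1 : test_function r (ball_ind 1) := test_le r1 (test_ball ltr01).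
rewrite (uniq _ tf) (uniq _ t1) mulf_eq0 negb_or => /andP[_ n0].
by rewrite -mulf_div divff // mulr1.
Qed.

(** The Haar integral giving mass 1 to the unit ball. Any admissible period may be selected, by
    [coset_sum_refine]; keeping it at most 1 makes the denominator nonzero. *)
Definition haar f : K :=
  let r := xget 1 [set r | [/\ 0 < r, r <= 1 & test_function r f]] in
  coset_sum r f / coset_sum r (ball_ind 1).

Lemma haarE r f : 0 < r -> r <= 1 -> test_function r f ->
  haar f = coset_sum r f / coset_sum r (ball_ind 1).
Proof.
move=> r0 r1 tf; rewrite /haar; case: xgetP => [r' _ [r'0 r'1 tf']|nr]; last first.
  by case: (nr r).
have [rr|/ltW rr] := leP r r'; first by rewrite -(coset_sum_refine r0 rr).
by rewrite (coset_sum_refine r'0 rr).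
Qed.

Lemma haar_linear r a f g : 0 < r -> test_function r f -> test_function r g ->
  haar (fun x => a * f x + g x) = a * haar f + haar g.
Proof.
move=> r0 tf tg; pose q := Num.min r 1.
have [q0 q1 qr] : [/\ 0 < q, q <= 1 & q <= r].
  by rewrite /q lt_min r0 ltr01 !ge_min !lexx orbT.
have {}tf := test_le qr tf; have {}tg := test_le qr tg.
rewrite !(@haarE q) ?coset_sum_linear //; last exact: test_linear.
by rewrite mulrDl mulrA.
Qed.

Lemma haarZ r a f : 0 < r -> test_function r f ->
  haar (fun x => a * f x) = a * haar f.
Proof.
(* To fit the form [a * f + g] of [haar_linear], [a * f] is seen as [(a - 1) * f + f]. *)
move=> r0 tf; rewrite -[in RHS](subrK 1 a) mulrDl mul1r -(haar_linear _ r0 tf tf).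
by congr haar; apply/funext => x; rewrite mulrBl mul1r subrK.
Qed.

Lemma haar_translate r h f : 0 < r -> test_function r f ->
  haar (fun x => f (x + h)) = haar f.
Proof.
move=> r0 tf; pose q := Num.min r 1.
have [q0 q1 qr] : [/\ 0 < q, q <= 1 & q <= r].
  by rewrite /q lt_min r0 ltr01 !ge_min !lexx orbT.
have {}tf := test_le qr tf.
by rewrite !(@haarE q) ?coset_sum_translate //; exact: test_translate.
Qed.

Lemma haar_ball1 : haar (ball_ind 1) = 1.
Proof.
rewrite (haarE ltr01 (lexx 1) (test_ball ltr01)) divff //.
exact: coset_sum_ball1_neq0.
Qed.

(** Uniqueness at radius [r] writes the mass 1 of the unit ball as a multiple of the mass of the
    smaller ball. *)
Lemma haar_ball_neq0 r : 0 < r -> r <= 1 -> haar (ball_ind r) != 0.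
Proof.
move=> r0 r1; have t1 := test_le r1 (test_ball ltr01).
have := haar_ball1; rewrite (coset_sum_unique r0 _ _ t1).
- by move=> e; apply: contra_eq_neq e => ->; rewrite mulr0 eq_sym oner_eq0.
- by move=> a f g; exact: haar_linear.
- by move=> h f; exact: haar_translate.
Qed.

End CosetSum.

(** * The modulus of a linear map *)

Section IntegralMatrices.
Variables (R : realType) (F : nonArchLocalFieldType R).

Lemma absv_prod_le1 (I : finType) (f : I -> F) :
  (forall i, absv (f i) <= 1) -> absv (\prod_i f i) <= 1.
Proof.
move=> f1; elim/big_ind: _ => [|a b ha hb|i _]; rewrite ?absv1 //.
by rewrite absvM mulr_ile1 ?absv_ge0.
Qed.

Lemma absv_sign (b : nat) : absv ((-1) ^+ b : F) = 1.
Proof. by rewrite absvX absvN absv1 expr1n. Qed.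

Lemma absv_det_le1 n (A : 'M[F]_n) : mxabs A <= 1 -> absv (\det A) <= 1.
Proof.
move=> /(mxabs_leP _ ler01) A1; apply: absv_sum_le => // s.
by rewrite absvM absv_sign mul1r absv_prod_le1.
Qed.

(** These matrices form GL_n over the ring of integers: the inverse is the adjugate divided by a
    unit, and cofactors are integral. *)
Lemma mxabs_invmx_le1 n (A : 'M[F]_n) :
  mxabs A <= 1 -> absv (\det A) = 1 -> A \in unitmx /\ mxabs (invmx A) <= 1.
Proof.
move=> A1 d1; have uA : A \in unitmx.
  by rewrite unitmxE unitfE -absv_eq0 d1 oner_eq0.
split=> //; rewrite /invmx uA mxabsZ absvV d1 invr1 mul1r.
apply/mxabs_leP => // i j; rewrite mxE /cofactor absvM absv_sign mul1r.
apply: absv_det_le1; apply/mxabs_leP => // k l; rewrite !mxE.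
by have /(mxabs_leP _ ler01) := A1.
Qed.

Lemma mxabs1_le1 n : mxabs (1%:M : 'M[F]_n) <= 1.
Proof.
by apply/mxabs_leP => // i j; rewrite mxE; case: (i == j); rewrite ?absv1 ?absv0.
Qed.

End IntegralMatrices.

(** * Characters of the general linear group trivial on integral matrices *)

Section Transpose.
Variables (R : realType) (F : nonArchLocalFieldType R) (K : fieldType) (n : nat).
Variable chi : 'M[F]_n.+1 -> K.
Hypothesis chiM : forall A B, A \in unitmx -> B \in unitmx ->
  chi (A *m B) = chi A * chi B.
Hypothesis chi_integral : forall A, mxabs A <= 1 -> absv (\det A) = 1 -> chi A = 1.

Lemma chi_inv A : A \in unitmx -> chi A * chi (invmx A) = 1.
Proof.
move=> uA; rewrite -chiM ?unitmx_inv // mulmxV //.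
by rewrite chi_integral ?mxabs1_le1 // det1 absv1.
Qed.

Lemma chi_conj D A : D \in unitmx -> A \in unitmx ->
  chi (D *m A *m invmx D) = chi A.
Proof.
move=> uD uA; rewrite !chiM ?unitmx_mul ?unitmx_inv ?uD //.
by rewrite mulrAC chi_inv // mul1r.
Qed.

(* Conjugation by a contracting diagonal matrix makes a unitriangular matrix
   integral. *)
Lemma chi_unitriangular (L : 'M[F]_n.+1) :
    (forall i j : 'I_n.+1, (i <= j)%N -> L i j = (i == j)%:R) ->
  chi L = 1 /\ chi L^T = 1.
Proof.
move=> Llow; have c0 : 0 < (1 + mxabs L)^-1 by rewrite invr_gt0 ltr_pwDl ?mxabs_ge0.
(* With this [t], conjugation by [D] turns the entries below the diagonal into
   [t ^+ (i - j) * L i j] with [i - j >= 1], which are integral. The matrix [B] is this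
   conjugate. *)
have [t t0 tL] := exists_small F c0.
have t1 : absv t <= 1.
  by rewrite (le_trans (ltW tL)) // invf_le1 ?lerDl ?mxabs_ge0 // ltr_pwDl ?mxabs_ge0.
pose D : 'M[F]_n.+1 := diag_mx (\row_i t ^+ i).
have uD : D \in unitmx.
  rewrite unitmxE det_diag unitfE; apply/prodf_neq0 => i _.
  by rewrite mxE expf_neq0.
pose B := \matrix_(i, j) (if (i <= j)%N then (i == j)%:R
                          else t ^+ (i - j) * L i j : F).
have DL : D *m L = B *m D.
  apply/matrixP => i j; rewrite mul_diag_mx mul_mx_diag !mxE.
  case: ifP => [ij|/negbT]; last first.
    by rewrite -ltnNge => ji; rewrite mulrAC -exprD subnK // ltnW.
  rewrite Llow //; case: eqP => [->|]; first by rewrite mulrC.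
  by rewrite mulr0 mul0r.
have B1 : mxabs B <= 1.
  apply/mxabs_leP => // i j; rewrite mxE; case: ifP => [_|/negbT].
    by case: (i == j); rewrite ?absv1 ?absv0.
  rewrite -ltnNge => ji; rewrite absvM absvX -(subnSK ji) exprS -mulrA.
  rewrite (@le_trans _ _ (absv t * mxabs L)) //.
    rewrite ler_wpM2l ?absv_ge0 // -[leRHS]mul1r ler_pM ?absv_ge0 //.
    - by rewrite exprn_ge0 ?absv_ge0.
    - by rewrite exprn_ile1 ?absv_ge0.
    - exact: absv_le_mxabs.
  rewrite (@le_trans _ _ (absv t * (1 + mxabs L))) //.
    by rewrite ler_wpM2l ?absv_ge0 // lerDr.
  by rewrite -ler_pdivlMr ?ltr_pwDl ?mxabs_ge0 // mul1r ltW.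
have dB : \det B = 1.
  rewrite det_trig; last first.
    apply/is_trig_mxP => i j ij; rewrite mxE ltnW //.
    by rewrite -val_eqE /= ltn_eqF.
  by rewrite big1 // => i _; rewrite mxE leqnn eqxx.
have uB : B \in unitmx by rewrite unitmxE dB unitr1.
have aB : absv (\det B) = 1 by rewrite dB absv1.
have LE : L = invmx D *m B *m invmx (invmx D) by rewrite invmxK -mulmxA -DL mulKmx.
have uDi : invmx D \in unitmx by rewrite unitmx_inv.
have uDt : D^T \in unitmx by rewrite unitmx_tr.
split; first by rewrite LE chi_conj // chi_integral.
rewrite LE !trmx_mul invmxK trmx_inv mulmxA chi_conj ?unitmx_tr //.
by rewrite chi_integral ?mxabs_tr ?det_tr.
Qed.

(** Factor [U = D L^T] with [D] the diagonal of [U] and [L] lower unitriangular: [chi] is 1 on [L]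
    and [L^T], and [D] is symmetric. *)
Lemma chi_triangular (U : 'M[F]_n.+1) : U \in unitmx ->
    (forall i j : 'I_n.+1, (j < i)%N -> U i j = 0) ->
  chi U^T = chi U.
Proof.
move=> uU Uup; pose D : 'M[F]_n.+1 := diag_mx (\row_i U i i).
have U0 i : U i i != 0.
  have tU : is_trig_mx U^T by apply/is_trig_mxP => k l kl; rewrite mxE Uup.
  have := uU; rewrite unitmxE -det_tr (det_trig tU) unitfE => /prodf_neq0/(_ i isT).
  by rewrite mxE.
have uD : D \in unitmx.
  by rewrite unitmxE det_diag unitfE; apply/prodf_neq0 => i _; rewrite mxE.
have [L UE uL] : exists2 L : 'M[F]_n.+1, U = D *m L^T & L \in unitmx.
  exists (invmx D *m U)^T; first by rewrite trmxK mulKVmx.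
  by rewrite unitmx_tr unitmx_mul unitmx_inv uD.
have Llow (i j : 'I_n.+1) : (i <= j)%N -> L i j = (i == j)%:R.
  move=> ij; have : U j i = (D *m L^T) j i by rewrite -UE.
  rewrite mul_diag_mx !mxE; move: ij; rewrite leq_eqVlt => /orP[/eqP/val_inj ->|ij].
    by rewrite eqxx -[LHS]mulr1 => /(mulfI (U0 j)).
  rewrite Uup // -val_eqE /= ltn_eqF // => /esym/eqP.
  by rewrite mulf_eq0 (negPf (U0 j)) => /eqP.
have [L1 Lt1] := chi_unitriangular Llow.
have uLt : L^T \in unitmx by rewrite unitmx_tr.
rewrite {2}UE {1}UE trmx_mul trmxK !chiM ?unitmx_tr //.
by rewrite L1 Lt1 mul1r mulr1 /D tr_diag_mx.
Qed.

(** In an LUP factorization [P A = L U], the permutation matrix [P] is integral and [L] is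
    unitriangular, so [chi A] is [chi U]. Likewise [chi A^T] is [chi U^T], which reduces to the
    triangular case. *)
Lemma chi_trmx A : A \in unitmx -> chi A^T = chi A.
Proof.
move=> uA; have := cormen_lup_correct A; have := @cormen_lup_lower _ _ A.
have := @cormen_lup_upper _ _ A; have := cormen_lup_perm A.
have := cormen_lup_detL A; case: (cormen_lup A) => -[P L] U /= dL Pp Uup Llow PA.
have [s sP] := is_perm_mxP _ Pp.
have P1 : mxabs P <= 1.
  rewrite sP; apply/mxabs_leP => // i j; rewrite !mxE.
  by case: (_ == _); rewrite ?absv1 ?absv0.
have dP : absv (\det P) = 1 by rewrite sP det_perm absv_sign.
have [uP _] := mxabs_invmx_le1 P1 dP.
have uL : L \in unitmx by rewrite unitmxE dL unitr1.
have uU : U \in unitmx.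
  have : P * A \in unitmx by rewrite unitmx_mul uP.
  by rewrite PA unitmx_mul => /andP[].
have [cL cLt] := chi_unitriangular Llow.
have cA : chi A = chi U.
  have := congr1 chi PA; rewrite /GRing.mul /= !chiM // cL mul1r.
  by rewrite (chi_integral P1) // mul1r.
have /(congr1 chi) : A^T *m P^T = U^T *m L^T by rewrite -!trmx_mul; congr (_^T).
rewrite !chiM ?unitmx_tr // cLt mulr1 (chi_integral _ _ (A := P^T)) ?mxabs_tr ?det_tr //.
by rewrite mulr1 => ->; rewrite cA chi_triangular.
Qed.

End Transpose.

(** * Linear change of variables in the Haar integral *)

Section Modulus.
Variables (R : realType) (F : nonArchLocalFieldType R) (K : numFieldType).

Section Fixed.
Variable N : nat.
Local Notation E := 'rV[F]_N.
Implicit Types (f : E -> K) (A B : 'M[F]_N).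

(** By uniqueness of the Haar measure, one ball suffices to define the factor of the change of
    variables; see [haar_mulmx]. *)
Definition modulus A : K := haar (fun x : E => ball_ind K 1 (x *m A)).

Lemma test_mulmx r f A : A \in unitmx -> 0 < r -> test_function r f ->
  test_function (r / (1 + mxabs A)) (fun x => f (x *m A)).
Proof.
move=> uA r0 [pf [s fs]]; split=> [x y xy|].
  apply: pf; rewrite -mulmxBl (le_lt_trans (mxabsM _ _)) //.
  have A0 : 0 < 1 + mxabs A by rewrite ltr_pwDl ?mxabs_ge0.
  rewrite ltr_pdivlMr // in xy; rewrite (le_lt_trans _ xy) //.
  by rewrite ler_wpM2l ?mxabs_ge0 // lerDr.
exists (s * mxabs (invmx A) + 1) => x /fs xs.
rewrite -(mulmxK uA x) (le_lt_trans (mxabsM _ _)) // ltr_pwDr //.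
by rewrite ler_wpM2r ?mxabs_ge0 // ltW.
Qed.

Lemma test_mulmx_gt0 r A : 0 < r -> 0 < r / (1 + mxabs A).
Proof. by move=> r0; rewrite divr_gt0 // ltr_pwDl ?mxabs_ge0. Qed.

(** Translating [f] by [h] translates [x |-> f (x *m A)] by [h A^-1], so the left side is an
    invariant functional of [f]. Uniqueness makes it a multiple of [haar], and the unit ball gives
    the constant. *)
Lemma haar_mulmx r f A : A \in unitmx -> 0 < r -> test_function r f ->
  haar (fun x => f (x *m A)) = modulus A * haar f.
Proof.
move=> uA r0 tf; pose q := Num.min r 1.
have [q0 q1 qr] : [/\ 0 < q, q <= 1 & q <= r].
  by rewrite /q lt_min r0 ltr01 !ge_min !lexx orbT.
have {}tf := test_le qr tf; have t1 := test_le q1 (@test_ball _ F K N _ ltr01).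
pose J (g : E -> K) : K := haar (fun x : E => g (x *m A)).
have JE : forall g, test_function q g ->
    J g = coset_sum q g * J (ball_ind K q).
  apply: coset_sum_unique => // [a g h tg th|h g tg].
    by apply: (haar_linear _ (test_mulmx_gt0 A q0)); exact: test_mulmx.
  rewrite /J -(haar_translate (h *m invmx A) (test_mulmx_gt0 A q0) (test_mulmx uA q0 tg)).
  by congr haar; apply/funext => x; rewrite mulmxDl mulmxKV.
rewrite -/(J f) JE // (haarE q0 q1 tf) /modulus -/(J (ball_ind K 1)) (JE _ t1).
by rewrite [RHS]mulrC -mulrA mulKf // coset_sum_ball1_neq0.
Qed.

Lemma modulusM A B : A \in unitmx -> B \in unitmx ->
  modulus (A *m B) = modulus A * modulus B.
Proof.
move=> uA uB; have t1 := test_mulmx uB ltr01 (@test_ball _ F K N _ ltr01).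
rewrite -(haar_mulmx uA (test_mulmx_gt0 B ltr01) t1).
by congr haar; apply/funext => x; rewrite mulmxA.
Qed.

Lemma modulus_integral A : mxabs A <= 1 -> absv (\det A) = 1 -> modulus A = 1.
Proof.
move=> A1 dA; have [uA iA1] := mxabs_invmx_le1 A1 dA.
rewrite -(@haar_ball1 _ F K N); congr haar; apply/funext => x; rewrite /ball_ind.
congr (_%:R); congr (nat_of_bool _).
have le (y : E) B : mxabs B <= 1 -> mxabs (y *m B) <= mxabs y.
  move=> B1; rewrite (le_trans (mxabsM _ _)) //.
  by rewrite ler_piMr ?mxabs_ge0.
suff -> : mxabs (x *m A) = mxabs x by [].
by apply/eqP; rewrite eq_le le //= -{1}(mulmxK uA x) le.
Qed.

End Fixed.

Lemma block_diagM n (A B C D : 'M[F]_n) :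
  block_mx A 0 0 B *m block_mx C 0 0 D = block_mx (A *m C) 0 0 (B *m D).
Proof. by rewrite mulmx_block !mulmx0 !mul0mx !addr0 add0r. Qed.

Lemma block_swap_diag n (A B : 'M[F]_n) :
  block_mx 0 1%:M 1%:M 0 *m block_mx A 0 0 B *m block_mx 0 1%:M 1%:M 0
  = block_mx B 0 0 A.
Proof.
rewrite !mulmx_block !mulmx0 !mul0mx !mul1mx !addr0 !add0r.
by rewrite ?mulmx1 ?mulmx0 ?addr0 ?add0r.
Qed.

(** Both diagonal blocks contribute through the same character [chi], because the matrix swapping
    them is integral. The modulus is thus [chi g] times [chi] of the transposed inverse, and [chi]
    is transpose invariant. *)
Lemma modulus_block_inv n (g : 'M[F]_n) : g \in unitmx ->
  modulus (block_mx g 0 0 (invmx g)^T) = 1.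
Proof.
(* Size 0 is treated apart, since the facts on [chi] concern matrices of size [n.+1]. *)
case: n g => [|n] g ug.
  by apply: modulus_integral; [apply/mxabs_leP => // -[]|rewrite det_mx00 absv1].
pose chi h := modulus (block_mx h 0 0 1%:M : 'M[F]_(n.+1 + n.+1)).
pose chi' h := modulus (block_mx 1%:M 0 0 h : 'M[F]_(n.+1 + n.+1)).
have ub h h' : h \in unitmx -> h' \in unitmx ->
    (block_mx h 0 0 h' : 'M[F]_(n.+1 + n.+1)) \in unitmx.
  by rewrite !unitmxE det_ublock unitrM => -> ->.
have u1 : (1%:M : 'M[F]_n.+1) \in unitmx by rewrite unitmx1.
have chiM A B : A \in unitmx -> B \in unitmx -> chi (A *m B) = chi A * chi B.
  move=> uA uB; rewrite /chi -(modulusM (ub _ _ uA u1) (ub _ _ uB u1)).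
  by rewrite block_diagM mulmx1.
have chi1 A : mxabs A <= 1 -> absv (\det A) = 1 -> chi A = 1.
  move=> A1 dA; apply: modulus_integral; last first.
    by rewrite det_ublock det1 mulr1.
  have /(mxabs_leP _ ler01) A1' := A1; have /(mxabs_leP _ ler01) o1 := mxabs1_le1 F n.+1.
  apply/mxabs_leP => // i j; rewrite -(splitK i) -(splitK j).
  case: (fintype.split i) => k; case: (fintype.split j) => l /=.
  - by rewrite block_mxEul.
  - by rewrite block_mxEur mxE absv0.
  - by rewrite block_mxEdl mxE absv0.
  - by rewrite block_mxEdr.
pose S : 'M[F]_(n.+1 + n.+1) := block_mx 0 1%:M 1%:M 0.
have SS : S *m S = 1%:M.
  by rewrite mulmx_block !mulmx0 !mul0mx !mulmx1 !addr0 !add0r -scalar_mx_block.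
have S1 : modulus S = 1.
  apply: modulus_integral; last first.
    apply/eqP; rewrite -(@pexpr_eq1 _ _ 2%N) ?absv_ge0 //.
    by rewrite expr2 -absvM -det_mulmx SS det1 absv1.
  have /(mxabs_leP _ ler01) o1 := mxabs1_le1 F n.+1.
  apply/mxabs_leP => // i j; rewrite -(splitK i) -(splitK j).
  case: (fintype.split i) => k; case: (fintype.split j) => l /=.
  - by rewrite block_mxEul mxE absv0.
  - by rewrite block_mxEur.
  - by rewrite block_mxEdl.
  - by rewrite block_mxEdr mxE absv0.
have uS : S \in unitmx by have /mulmx1_unit[] := SS.
have chi'E h : h \in unitmx -> chi' h = chi h.
  move=> uh; rewrite /chi' -(block_swap_diag h) -/S.
  have uSh : S *m block_mx h 0 0 1%:M \in unitmx by rewrite unitmx_mul uS ub.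
  by rewrite (modulusM uSh uS) (modulusM uS (ub _ _ uh u1)) S1 mul1r mulr1.
have -> : block_mx g 0 0 (invmx g)^T =
    block_mx g 0 0 1%:M *m block_mx 1%:M 0 0 (invmx g)^T.
  by rewrite block_diagM mulmx1 mul1mx.
have uig : (invmx g)^T \in unitmx by rewrite unitmx_tr unitmx_inv.
rewrite (modulusM (ub _ _ ug u1) (ub _ _ u1 uig)) -/(chi g) -/(chi' _) chi'E //.
by rewrite (chi_trmx chiM chi1) ?unitmx_inv // (chi_inv chiM chi1).
Qed.

End Modulus.

(** * Coordinates on GL(W) x W x W^* *)

Section Topology.
Variables (R : realType) (F : nonArchLocalFieldType R).

Lemma mx_linear_bounded m n p q (f : {linear 'M[F]_(m, n) -> 'M[F]_(p, q)}) :
  exists2 C : R, 0 < C & forall X, mxabs (f X) <= C * mxabs X.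
Proof.
pose C0 := \big[Num.max/0]_(ij : 'I_m * 'I_n) mxabs (f (delta_mx ij.1 ij.2)).
have C00 : 0 <= C0.
  by rewrite /C0; elim/big_ind: _ => // [x y x0 y0|ij _]; rewrite ?le_max ?x0 ?mxabs_ge0.
exists (1 + C0); first by rewrite ltr_pwDl.
move=> X; have C1 : 0 <= (1 + C0) * mxabs X by rewrite mulr_ge0 ?addr_ge0 ?mxabs_ge0.
rewrite {1}(matrix_sum_delta X) linear_sum.
elim/big_ind: _ => [|A B hA hB|i _]; rewrite ?mxabs0 ?mxabsD_le //.
rewrite linear_sum; elim/big_ind: _ => [|A B hA hB|j _]; rewrite ?mxabs0 ?mxabsD_le //.
rewrite linearZ mxabsZ mulrC ler_pM ?mxabs_ge0 ?absv_ge0 ?absv_le_mxabs //.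
rewrite (@le_trans _ _ C0) ?lerDr //.
exact: (le_bigmax _ (fun ij : 'I_m * 'I_n => mxabs (f (delta_mx ij.1 ij.2))) (i, j)).
Qed.

Lemma nbhs_initial (S : choiceType) (X : topologicalType) (f : S -> X)
    (x : initial_topology f) (A : set (initial_topology f)) :
  nbhs x A <-> exists2 B, nbhs (f x) B & f @^-1` B `<=` A.
Proof.
split=> [[_ [[B oB <-] Bx BA]]|[B Bx BA]].
  by exists B => //; exact: open_nbhs_nbhs.
by apply: filterS BA _; exact: (@initial_continuous _ _ f x B Bx).
Qed.

(** The linear maps between these coordinates and those of [vbasis] are bounded in both directions.
    Matrices of endomorphisms and rows of forms can thus measure neighbourhoods. *)
Lemma nbhs_vtop (V : vectType F) p q (f : {linear V -> 'M[F]_(p, q)})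
    (g : {linear 'M[F]_(p, q) -> V}) : cancel f g ->
  forall (v : vtop V) (A : set (vtop V)), nbhs v A <->
    exists2 e : R, 0 < e & [set y | mxabs (f y - f v) < e] `<=` A.
Proof.
move=> fK v A; pose h := rVof (vbasis {:V}).
have hK : cancel h (vecof (vbasis {:V})) by apply/rVofK/vbasisP.
have [C C0 hC] := mx_linear_bounded (h \o g).
have [D D0 fD] := mx_linear_bounded (f \o vecof (vbasis {:V})).
rewrite nbhs_initial; split=> [[B /nbhs_mxabs[e e0 eB] BA]|[e e0 eA]].
  exists (e / C); first by rewrite divr_gt0.
  move=> y /= yv; apply: BA; apply: eB => /=; rewrite -/h -linearB /=.
  rewrite -[y - v]fK (le_lt_trans (hC _)) // linearB mulrC -ltr_pdivlMr //.
exists [set z | mxabs (z - h v) < e / D].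
  by apply/nbhs_mxabs; exists (e / D); rewrite ?divr_gt0.
move=> y /= yv; apply: eA => /=; rewrite -linearB /= -[y - v]hK.
by rewrite (le_lt_trans (fD _)) // /h linearB mulrC -ltr_pdivlMr.
Qed.

End Topology.

Section Coordinates.
Variables (R : realType) (F : nonArchLocalFieldType R) (W : vectType F).
Variable b : (\dim {:W}).-tuple W.
Hypothesis hb : basis_of {:W} b.
Local Notation m := (\dim {:W}).
Implicit Types (w : W) (l : dual W) (x y z : GL W).

Definition dual_row l : 'rV[F]_m := \row_i l b`_i.

Lemma dual_row_linear : linear dual_row.
Proof.
by move=> a l l'; apply/rowP => i; rewrite !mxE add_lfunE scale_lfunE.
Qed.

HB.instance Definition _ := GRing.isSemilinear.Build F _ _ _ dual_row
  (GRing.semilinear_linear dual_row_linear).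

Lemma dual_row_basis_map w : dual_row (dual_basis_map b w) = rVof b w.
Proof. by apply/rowP => i; rewrite !mxE dual_basis_map_basis. Qed.

Lemma rVof_basis_mapV l : rVof b ((dual_basis_map b)^-1%VF l) = dual_row l.
Proof. by rewrite -dual_row_basis_map dual_basis_mapVK. Qed.

Lemma dual_rowK : cancel dual_row (dual_basis_map b \o vecof b).
Proof. by move=> l /=; rewrite -rVof_basis_mapV rVofK // dual_basis_mapVK. Qed.

Lemma dual_appE l w : l w = (rVof b w *m (dual_row l)^T) 0 0.
Proof.
rewrite {1}(coord_basis hb (memvf w)) linear_sum mxE; apply: eq_bigr => i _.
by rewrite linearZ !mxE.
Qed.

Lemma absv_app_le l w : absv (l w) <= mxabs (rVof b w) * mxabs (dual_row l).
Proof.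
by rewrite dual_appE (le_trans (absv_le_mxabs _ _ _)) // -(mxabs_tr (dual_row l)) mxabsM.
Qed.

Lemma dual_row_comp l (x : 'End(W)) :
  dual_row (l \o x)%VF = dual_row l *m (mxof b b x)^T.
Proof.
apply/rowP => i; rewrite [LHS]mxE comp_lfunE dual_appE (rVof_app _ hb).
by rewrite rVofE // -rowE !mxE; apply: eq_bigr => j _; rewrite !mxE mulrC.
Qed.

Lemma mxof_conj (g x : GL W) :
  mxof b b (GLconj g x) = mxof b b (GLinv g) *m mxof b b x *m mxof b b g.
Proof.
have -> : (GLconj g x : 'End(W)) = ((g \o x) \o GLinv g)%VF by [].
by rewrite !(mxof_comp _ _ hb) mulmxA.
Qed.

Lemma mxof_GLK (g : GL W) : mxof b b (GLinv g) *m mxof b b g = 1%:M.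
Proof.
rewrite -(mxof_comp _ _ hb) -(mxof1 (basis_free hb)); congr mxof.
by apply/lfunP => w; rewrite comp_lfunE id_lfunE GLVK.
Qed.

Lemma mxof_GL_unit (g : GL W) : mxof b b g \in unitmx.
Proof. by have /mulmx1_unit[] := mxof_GLK g. Qed.

Lemma mxof_GLinv (g : GL W) : mxof b b (GLinv g) = invmx (mxof b b g).
Proof. by rewrite -[LHS]mulmx1 -(mulmxV (mxof_GL_unit g)) mulmxA mxof_GLK mul1mx. Qed.

Lemma nbhs_End (x : 'End(W)) (A : set (vtop 'End(W))) :
  nbhs (x : vtop 'End(W)) A <-> exists2 e : R, 0 < e &
  [set y : 'End(W) | mxabs (mxof b b y - mxof b b x) < e] `<=` A.
Proof.
exact: (@nbhs_vtop _ F 'End(W) m m [the {linear _ -> _} of mxof b b]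
  [the {linear _ -> _} of hommx b b] (mxofK hb hb)).
Qed.

Lemma nbhs_GL x (A : set (GL W)) : nbhs x A <-> exists2 e : R, 0 < e &
  [set y : GL W | mxabs (mxof b b y - mxof b b x) < e] `<=` A.
Proof.
rewrite (nbhs_initial (f := fun g : GL W => val g : vtop 'End(W))); split.
  move=> [B /nbhs_End [e e0 eB] BA].
  by exists e => // y /= yx; apply: BA; apply: eB.
move=> [e e0 eA]; exists [set y : vtop 'End(W) | mxabs (mxof b b y - mxof b b x) < e].
  by apply/nbhs_End; exists e.
by move=> y /= yx; apply: eA.
Qed.

Definition triple_ball (p : triples W) (e : R) : set (triples W) :=
  [set q | [/\ mxabs (mxof b b (q.1.1 : GL W) - mxof b b (p.1.1 : GL W)) < e,
               mxabs (rVof b q.1.2 - rVof b p.1.2) < e &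
               mxabs (dual_row q.2 - dual_row p.2) < e]].

Lemma nbhs_triples (p : triples W) (A : set (triples W)) :
  nbhs p A <-> exists2 e : R, 0 < e & triple_ball p e `<=` A.
Proof.
split.
  move=> [[P Q] /= [[[P1 P2] /= [p1 p2] PP] p3] PQA].
  have [e1 e10 eP1] := (nbhs_GL _ _).1 p1.
  have [e2 e20 eP2] := (nbhs_vtop (f := rVof b) (rVofK hb) _ _).1 p2.
  have [e3 e30 eP3] := (nbhs_vtop dual_rowK _ _).1 p3.
  exists (Num.min e1 (Num.min e2 e3)); first by rewrite !lt_min e10 e20.
  move=> [[x w] l] [/=]; rewrite !lt_min => /and3P[h1 _ _] /and3P[_ h2 _] /and3P[_ _ h3].
  apply: PQA; split; last exact: eP3.
  by apply: PP; split; [exact: eP1|exact: eP2].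
move=> [e e0 eA].
exists ([set q : GL W * vtop W | mxabs (mxof b b q.1 - mxof b b (p.1.1 : GL W)) < e /\
    mxabs (rVof b q.2 - rVof b p.1.2) < e],
  [set l : vtop (dual W) | mxabs (dual_row l - dual_row p.2) < e]); last first.
  by move=> [[x w] l] /= [[h1 h2] h3]; apply: eA.
split; last by apply/(nbhs_vtop dual_rowK); exists e.
exists ([set x : GL W | mxabs (mxof b b x - mxof b b (p.1.1 : GL W)) < e],
  [set w : vtop W | mxabs (rVof b w - rVof b p.1.2) < e]) => //.
split; first by apply/nbhs_GL; exists e.
by apply/(nbhs_vtop (f := rVof b) (rVofK hb)); exists e.
Qed.

Lemma triple_ball_trans p q t e :
  triple_ball p e q -> triple_ball q e t -> triple_ball p e t.
Proof.
have tr k n (A B C : 'M[F]_(k, n)) :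
    mxabs (B - A) < e -> mxabs (C - B) < e -> mxabs (C - A) < e.
  by move=> h1 h2; rewrite -(subrK B C) -addrA mxabsD_lt.
move=> [h1 h2 h3] [k1 k2 k3]; split; [exact: tr k1|exact: tr k2|exact: tr k3].
Qed.

(** [A X B - X = (A - 1) X B + X (B - 1)], and [B] is integral because [r <= 1]. *)
Lemma conj_near n (A X B : 'M[F]_n) (r : R) : r <= 1 ->
  mxabs (A - 1%:M) < r -> mxabs (B - 1%:M) < r ->
  mxabs (A *m X *m B - X) <= r * mxabs X.
Proof.
move=> r1 hA hB; have r0 : 0 <= r by rewrite (le_trans (mxabs_ge0 _) (ltW hA)).
have B1 : mxabs B <= 1.
  by rewrite -(subrK 1%:M B) mxabsD_le ?mxabs1_le1 // (le_trans (ltW hB)).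
have -> : A *m X *m B - X = (A - 1%:M) *m X *m B + X *m (B - 1%:M).
  by rewrite mulmxBl mul1mx mulmxBl mulmxBr mulmx1 addrA subrK.
apply: mxabsD_le.
  rewrite (le_trans (mxabsM _ _)) // -[leRHS]mulr1 ler_pM ?mxabs_ge0 //.
  rewrite (le_trans (mxabsM _ _)) // ler_wpM2r ?mxabs_ge0 //.
  exact: ltW.
rewrite (le_trans (mxabsM _ _)) // mulrC ler_wpM2r ?mxabs_ge0 //.
exact: ltW.
Qed.

End Coordinates.

(** * Uniform estimates, slices and tensors of Schwartz functions *)

Section SchwartzFunctions.
Variables (R : realType) (F : nonArchLocalFieldType R) (W : vectType F).
Variable b : (\dim {:W}).-tuple W.
Hypothesis hb : basis_of {:W} b.
Implicit Types (w : W) (l : dual W) (x g k : GL W).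
Implicit Types f : schwartz R (triples W).

Lemma closed_locally_constant (X : topologicalType) (f : X -> R[i]) :
  locally_constant f -> closed [set x | f x != 0].
Proof. by move=> lf x /(_ _ (lf x))[y [/= + <-]]. Qed.

Lemma schwartz_locally_constant (X : topologicalType) (f : schwartz R X) :
  locally_constant f.
Proof. by have /asboolP[] := schwartzP f. Qed.

Lemma schwartz_compact (X : topologicalType) (f : schwartz R X) :
  compact [set x | f x != 0].
Proof.
have /asboolP[lf] := schwartzP f; rewrite /compactly_supported.
by rewrite -(closure_id _).1 //; exact: closed_locally_constant.
Qed.

Lemma schwartz_predI (X : topologicalType) (f : X -> R[i]^o) (C : set X) :
    locally_constant f -> compact C -> [set x | f x != 0] `<=` C ->
  f \in @schwartz_pred R X.
Proof.
move=> lf cC fC; apply/asboolP; split=> //; rewrite /compactly_supported.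
have cf := closed_locally_constant lf.
by rewrite -(closure_id _).1 //; exact: subclosed_compact cf cC fC.
Qed.

(** Conjugation involves [k] and its inverse; constraining both also makes the condition symmetric
    under inversion. *)
Definition near_one (r : R) k :=
  mxabs (mxof b b k - 1%:M) < r /\ mxabs (mxof b b (GLinv k) - 1%:M) < r.

Lemma near_oneV r k : near_one r k -> near_one r (GLinv k).
Proof. by rewrite /near_one GLinvK => -[]. Qed.

(** Uniform local constancy, from compactness of the support. The first factor varies only by small
    conjugations, which is how points move along the orbit later. *)
Lemma schwartz_uniform f : exists2 r : R, 0 < r &
  forall k x w l w' l', near_one r k ->
    mxabs (rVof b w' - rVof b w) < r ->
    mxabs (dual_row b l' - dual_row b l) < r ->
  f (GLconj k x, w', l') = f (x, w, l).
Proof.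
pose P (r : R) (p : triples W) := forall k w l, near_one r k ->
  mxabs (rVof b w - rVof b p.1.2) < r ->
  mxabs (dual_row b l - dual_row b p.2) < r -> f (GLconj k p.1.1, w, l) = f p.
have nearP (p : triples W) : \forall p' \near p & r \near 0^'+, P r p'.
  have /(nbhs_triples hb)[e e0 fe] := schwartz_locally_constant f p.
  (* [M] bounds the matrices of all points of the ball, so by [conj_near] a conjugation moves them
     by at most [r * M < e]. *)
  pose M := mxabs (mxof b b (p.1.1 : GL W)) + e.
  have M0 : 0 < M by rewrite ltr_wpDl ?mxabs_ge0.
  pose c := Num.min 1 (Num.min e (e / M)).
  have c0 : 0 < c by rewrite !lt_min ltr01 e0 divr_gt0.
  exists (triple_ball b p e, [set r | r < c]).
    split; last exact: nbhs_right_lt.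
    by apply/(nbhs_triples hb); exists e.
  move=> [q r] [/= pq]; rewrite !lt_min => /and3P[r1 re reM] k w l [k1 k2] qw ql.
  rewrite (fe q pq); apply: (fe (GLconj k q.1.1, w, l)).
  apply: (triple_ball_trans pq); split=> /=; last 2 first.
  - exact: lt_trans qw re.
  - exact: lt_trans ql re.
  rewrite mxof_conj // (le_lt_trans (conj_near _ (ltW r1) k2 k1)) //.
  have r0 : 0 <= r by rewrite (le_trans (mxabs_ge0 _) (ltW k1)).
  rewrite (@le_lt_trans _ _ (r * M)) ?ler_wpM2l -?ltr_pdivlMr //.
  case: pq => pq _ _.
  rewrite -(subrK (mxof b b (p.1.1 : GL W)) (mxof b b _)) mxabsD_le // /M.
    by rewrite (le_trans (ltW pq)) // lerDr mxabs_ge0.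
  by rewrite lerDl ltW.
have /compact_near_coveringP/(_ _ _ P) cK := @schwartz_compact _ f.
have nK := cK _ _ (fun p _ => nearP p).
have [r [r0 rP]] := filter_ex (filterI (nbhs_right_gt (0 : R)) (nK _)).
exists r => // k x w l w' l' kr ww' ll'.
(* Compactness controls only points of the support. If [f] vanishes at the first point but not at
   the second, the estimate is applied at the second one with [GLinv k]. *)
have [f0|fN0] := eqVneq (f (x, w, l)) 0; last exact: (rP (x, w, l)).
have [->|fN0] := eqVneq (f (GLconj k x, w', l')) 0; first by rewrite f0.
have := rP _ fN0 (GLinv k) w l (near_oneV kr); rewrite /= GLconjK => <- //.
- by rewrite mxabsB.
- by rewrite mxabsB.
Qed.

Lemma schwartz_bounded f : exists2 s : R, 1 <= s &
  forall x w l, f (x, w, l) != 0 ->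
    mxabs (rVof b w) < s /\ mxabs (dual_row b l) < s.
Proof.
(* The bound is written [r^-1] so that large bounds correspond to positive [r] tending to 0. *)
pose P (r : R) (p : triples W) :=
  mxabs (rVof b p.1.2) < r^-1 /\ mxabs (dual_row b p.2) < r^-1.
have nearP (p : triples W) : \forall p' \near p & r \near 0^'+, P r p'.
  pose M := mxabs (rVof b p.1.2) + mxabs (dual_row b p.2) + 1.
  have M0 : 0 < M by rewrite ltr_wpDl ?addr_ge0 ?mxabs_ge0.
  exists (triple_ball b p 1, [set r | 0 < r < M^-1]).
    split; first by apply/(nbhs_triples hb); exists 1.
    have Mi0 : 0 < M^-1 by rewrite invr_gt0.
    near=> r; apply/andP; split; near: r; [exact: nbhs_right_gt|exact: nbhs_right_lt].
  move=> [q r] [/= [_ q2 q3] /andP[r0 rM]].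
  have rM' : M < r^-1 by rewrite -[M]invrK ltf_pV2 ?posrE ?invr_gt0.
  have a0 := mxabs_ge0 (rVof b p.1.2); have c0 := mxabs_ge0 (dual_row b p.2).
  split; rewrite (lt_trans _ rM') //.
    rewrite -(subrK (rVof b p.1.2) (rVof b q.1.2)) mxabsD_lt // /M.
      by rewrite (lt_le_trans q2) // lerDr addr_ge0.
    by rewrite -addrA ltrDl ltr_wpDl.
  rewrite -(subrK (dual_row b p.2) (dual_row b q.2)) mxabsD_lt // /M.
    by rewrite (lt_le_trans q3) // lerDr addr_ge0.
  by rewrite -addrA addrC -addrA ltrDl ltr_pwDl.
have /compact_near_coveringP/(_ _ _ P) cK := @schwartz_compact _ f.
have nK := cK _ _ (fun p _ => nearP p).
have [r [r0 rP]] := filter_ex (filterI (nbhs_right_gt (0 : R)) (nK _)).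
exists (Num.max 1 r^-1) => [|x w l /rP[/= h1 h2]]; first by rewrite le_max lexx.
by rewrite !lt_max h1 h2 !orbT.
Unshelve. all: by end_near. Qed.

Lemma slice_subproof f g w l :
  (fun x : GL W => f (GLconj g x, w, l) : R[i]^o) \in @schwartz_pred R (GL W).
Proof.
have cg (h : GL W) : continuous (fun x => GLconj h x).
  exact: (GLconj_continuous (fun x => cvg_id)).
apply: (@schwartz_predI _ _
  ((fun p : triples W => GLconj (GLinv g) p.1.1) @` [set p | f p != 0])).
- move=> x.
  have ct : continuous (fun x : GL W => (GLconj g x, w, l) : triples W).
    apply: (@triple_continuous _ _ _ _ (fun x => GLconj g x) (fun=> w) (fun=> l)).
    + exact: cg.
    + exact: cst_continuous.
    + exact: cst_continuous.
  exact: (ct x _ (schwartz_locally_constant f (GLconj g x, w, l))).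
- apply: continuous_compact; last exact: schwartz_compact.
  apply: continuous_subspaceT.
  exact: (GLconj_continuous (@triple_fst_continuous _ _ W)).
- by move=> x /= fx; exists (GLconj g x, w, l) => //=; rewrite GLconjK.
Qed.

Definition slice f g w l : schwartz R (GL W) := Schwartz (slice_subproof f g w l).

Lemma slice_linear (a : R[i]) f f' g w l :
  slice (a *: f + f') g w l = a *: slice f g w l + slice f' g w l.
Proof. by apply/val_inj/funext => x. Qed.

Lemma slice_eq0 f g w l : (forall x, f (x, w, l) = 0) -> slice f g w l = 0.
Proof. by move=> f0; apply/val_inj/funext => x; exact: f0. Qed.

Definition base_ball w l (r : R) (p : triples W) :=
  (mxabs (rVof b p.1.2 - rVof b w) < r) && (mxabs (dual_row b p.2 - dual_row b l) < r).

Lemma tensor_ball_subproof (phi : schwartz R (GL W)) w l r :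
  (fun p : triples W => phi p.1.1 * (base_ball w l r p)%:R : R[i]^o)
    \in @schwartz_pred R (triples W).
Proof.
have [r0|r0] := leP r 0.
  rewrite (_ : (fun p => _) = schwartz_val (0 : schwartz R (triples W))).
    exact: schwartzP.
  apply/funext => p; rewrite /base_ball ltNge (le_trans r0 (mxabs_ge0 _)) /=.
  exact: mulr0.
pose Cw : set (vtop W) := vecof b @` [set z | mxabs z <= mxabs (rVof b w) + r].
pose Cl : set (vtop (dual W)) :=
  (dual_basis_map b \o vecof b) @` [set z | mxabs z <= mxabs (dual_row b l) + r].
have cv n (V : vectType F) (h : {linear 'rV[F]_n -> V}) (h' : {linear V -> 'rV[F]_n}) :
    cancel h' h -> cancel h h' -> continuous (h : 'rV[F]_n -> vtop V).
  move=> hK h'K x A /(nbhs_vtop hK)[e e0 eA].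
  by apply/nbhs_mxabs; exists e => // y /= yx; apply: eA => /=; rewrite !h'K.
have cCw : compact Cw.
  apply: continuous_compact; last exact: compact_mxabs_le.
  apply: continuous_subspaceT.
  by apply: (cv _ _ _ (rVof b)); [exact: rVofK|exact: vecofK].
have cCl : compact Cl.
  apply: continuous_compact; last exact: compact_mxabs_le.
  apply: continuous_subspaceT; apply: (cv _ _ _ (dual_row b)).
    exact: dual_rowK.
  by move=> z /=; rewrite dual_row_basis_map ?vecofK.
have lball (p q : triples W) : triple_ball b p r q ->
    base_ball w l r q = base_ball w l r p.
  move=> [_ q2 q3]; rewrite /base_ball; congr (_ && _).
    by apply: mxabsBD_lt; rewrite opprB addrA subrK.
  by apply: mxabsBD_lt; rewrite opprB addrA subrK.
apply: (schwartz_predI (C := ([set x | phi x != 0] `*` Cw) `*` Cl)).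
- move=> p; have lp := schwartz_locally_constant phi (p.1.1).
  have /(nbhs_triples hb)[e e0 eP] := @triple_fst_continuous _ _ W p _ lp.
  apply/(nbhs_triples hb); exists (Num.min e r); first by rewrite lt_min e0.
  move=> q [] /=; rewrite !lt_min => /andP[h1 k1] /andP[h2 k2] /andP[h3 k3].
  rewrite (lball p q) //; congr (_ * _); exact: (eP q).
- by do 2![apply: compact_setX => //]; exact: schwartz_compact.
- move=> [[x w'] l'] /=; case: (boolP (base_ball _ _ _ _)) => [|_]; last first.
    by rewrite mulr0 eqxx.
  move=> /andP[/= hw hl]; rewrite mulr1 => phix; split; first split=> //=.
    exists (rVof b w'); last by rewrite rVofK.
    rewrite /= -(subrK (rVof b w) (rVof b w')) mxabsD_le //.
      by rewrite (le_trans (ltW hw)) // lerDr mxabs_ge0.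
    by rewrite lerDl ltW.
  exists (dual_row b l'); last by rewrite dual_rowK.
  rewrite /= -(subrK (dual_row b l) (dual_row b l')) mxabsD_le //.
    by rewrite (le_trans (ltW hl)) // lerDr mxabs_ge0.
  by rewrite lerDl ltW.
Qed.

Definition tensor_ball phi w l r : schwartz R (triples W) :=
  Schwartz (tensor_ball_subproof phi w l r).

End SchwartzFunctions.

(** * Frobenius descent *)

Section Descent.
Variables (R : realType) (F : nonArchLocalFieldType R) (W : vectType F).
Implicit Types (w : W) (l : dual W) (x g k : GL W).

Lemma GLinvM g k v : GLinv (GLmul g k) v = GLinv k (GLinv g v).
Proof. by apply: (GL_inj (g := GLmul g k)); rewrite GLVK GLmulE !GLVK. Qed.

(** The scalars [a] and [c] are independent, so that pairs with [absv (l w) = 1] but different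
    values [l w] can be joined. *)
Definition carries k w l w' l' :=
  (exists2 a : F, a != 0 & k w = a *: w') /\
  (exists2 c : F, c != 0 & (l' \o k)%VF = c *: l).

Lemma carries_comp g k w l w1 l1 w2 l2 :
  carries g w l w1 l1 -> carries k w1 l1 w2 l2 -> carries (GLmul k g) w l w2 l2.
Proof.
move=> [[a a0 ga] [c c0 gc]] [[d d0 kd] [e e0 ke]]; split.
  by exists (a * d); rewrite ?mulf_neq0 // GLmulE ga linearZ /= kd scalerA.
exists (e * c); rewrite ?mulf_neq0 //; apply/lfunP => v.
have /lfunP/(_ v) := gc; have /lfunP/(_ (g v)) := ke.
by rewrite !comp_lfunE !scale_lfunE => -> ->; rewrite scalerA.
Qed.

Lemma carriesV k w l w' l' : carries k w l w' l' -> carries (GLinv k) w' l' w l.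
Proof.
move=> [[a a0 ka] [c c0 kc]]; split.
  exists a^-1; rewrite ?invr_neq0 //; apply: (GL_inj (g := k)).
  by rewrite GLVK linearZ /= ka scalerA mulVf // scale1r.
exists c^-1; rewrite ?invr_neq0 //; apply/lfunP => v.
rewrite comp_lfunE scale_lfunE -{2}(GLVK k v).
have /lfunP/(_ (GLinv k v)) := kc; rewrite comp_lfunE scale_lfunE => ->.
by rewrite scalerA mulVf // scale1r.
Qed.

(* The transvections v |-> v + m(v) z interpolate between nearby pairs (w, l). *)
Lemma transvection (z : W) (m : dual W) : 1 + m z != 0 -> exists k : GL W,
  (forall v, k v = v + m v *: z) /\
  (forall v, GLinv k v = v - ((1 + m z)^-1 * m v) *: z).
Proof.
move=> mz; pose f v := m v *: z.
have f_lin : linear f by move=> a v w; rewrite /f linearP scalerDl scalerA.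
pose fL := HB.pack_for {linear W -> W} f (GRing.isLinear.Build F W W _ f f_lin).
pose h (a : F) : 'End(W) := (\1 + a *: linfun fL)%VF.
have hE a v : h a v = v + (a * m v) *: z.
  by rewrite add_lfunE id_lfunE scale_lfunE lfunE /= /f scalerA.
(* Composing [h a] and [h c] gives the parameter [a + c + a c m(z)], so the parameter inverse to 1
   is [- (1 + m z)^-1]. *)
have hK a c : a + c + a * c * m z = 0 -> cancel (h a) (h c).
  move=> ac v; rewrite !hE linearD linearZ /= -addrA -scalerDl.
  have -> : a * m v + c * (m v + (a * m v) *: m z) = 0; last by rewrite scale0r addr0.
  rewrite [_ *: m z]/(_ * _) -[RHS](mul0r (m v)) -ac !mulrDl !mulrDr.
  by rewrite addrA; congr (_ + _); rewrite !mulrA [c * a]mulrC -!mulrA [m v * m z]mulrC.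
have e1 : 1 - (1 + m z)^-1 + 1 * - (1 + m z)^-1 * m z = 0.
  have := mulVf mz; rewrite mulrDr mulr1 => hi.
  by rewrite mul1r mulNr -addrA -opprD hi subrr.
have e2 : - (1 + m z)^-1 + 1 + - (1 + m z)^-1 * 1 * m z = 0.
  by rewrite [X in X + _]addrC mulr1 -[RHS]e1 mul1r.
have h1 : lker (h 1) == 0%VS by apply/lker0P/(can_inj (hK _ _ e1)).
exists (Sub (h 1) h1); split=> v; first by rewrite hE mul1r.
apply: (GL_inj (g := Sub (h 1) h1)); rewrite GLVK.
rewrite -[LHS](hK _ _ e2); congr (h 1 _).
by rewrite hE mulNr scaleNr.
Qed.

Section Coordinates.
Variable b : (\dim {:W}).-tuple W.
Hypothesis hb : basis_of {:W} b.

Lemma dual_rowB l l' : dual_row b (l - l') = dual_row b l - dual_row b l'.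
Proof. by apply/rowP => i; rewrite !mxE add_lfunE opp_lfunE. Qed.

Lemma mxof_rank1 (k : 'End(W)) (z : W) (m : dual W) :
  (forall v, k v = v + m v *: z) ->
  mxof b b k - 1%:M = (dual_row b m)^T *m rVof b z.
Proof.
move=> kE; apply/row_matrixP => i; rewrite linearB /= !rowE mulmx1.
rewrite -(rVofE hb) -(rVof_app _ hb) kE linearD linearZ /= addrC addKr.
by rewrite mulmxA rVofE // -rowE; apply/rowP => j; rewrite !mxE big_ord1 !mxE.
Qed.

(** Both [k - 1] and [k^-1 - 1] have rank at most one; they differ by the factor [- (1 + m z)^-1],
    of absolute value 1, hence obey the same bound. *)
Lemma transvection_near (z : W) (m : dual W) (r : R) :
    absv (1 + m z) = 1 -> mxabs (dual_row b m) * mxabs (rVof b z) < r ->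
  exists2 k : GL W, (forall v, k v = v + m v *: z) & near_one b r k.
Proof.
move=> mz1 mzr; have mz : 1 + m z != 0 by rewrite -absv_eq0 mz1 oner_eq0.
have [k [kE kVE]] := transvection mz; exists k => //; split.
  by rewrite (mxof_rank1 kE) (le_lt_trans (mxabsM _ _)) // mxabs_tr.
rewrite (mxof_rank1 (z := z) (m := - (1 + m z)^-1 *: m)); last first.
  by move=> v; rewrite kVE scale_lfunE !scaleNr.
rewrite (le_lt_trans (mxabsM _ _)) // mxabs_tr linearZ mxabsZ absvN absvV.
by rewrite mz1 invr1 mul1r.
Qed.

(** Take [m = l / l(w)] and [z = w' - w]: then [k w = w'], while [l] is only multiplied by
    [l(w') / l(w)]. *)
Lemma carry_vector (r : R) w w' l : absv (l w) = 1 -> absv (l w') = 1 ->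
    mxabs (dual_row b l) * mxabs (rVof b (w' - w)) < r ->
  exists2 k, carries k w l w' l & near_one b r k.
Proof.
move=> lw lw' lr; pose m : dual W := (l w)^-1 *: l.
have lw0 : l w != 0 by rewrite -absv_eq0 lw oner_eq0.
have mE v : m v = (l w)^-1 * l v by rewrite scale_lfunE.
have mz : 1 + m (w' - w) = (l w)^-1 * l w'.
  by rewrite mE linearB mulrBr mulVf // addrC subrK.
have [||k kE kr] := @transvection_near (w' - w) m r.
- by rewrite mz absvM absvV lw lw' invr1 mul1r.
- by rewrite linearZ mxabsZ absvV lw invr1 mul1r.
exists k => //; split.
  by exists 1; rewrite ?oner_eq0 // kE mE mulVf // !scale1r addrC subrK.
exists ((l w)^-1 * l w').
  by rewrite mulf_neq0 ?invr_eq0 // -absv_eq0 lw' oner_eq0.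
apply/lfunP => v; rewrite comp_lfunE kE linearD linearZ /= [RHS]scale_lfunE -mz.
by rewrite scalerDl scale1r !mE; congr (_ + _); exact: mulrAC.
Qed.

(** Take [m = (l - l') / l'(w)] and [z = w]: then [l' o k = l], while [w] is only rescaled. *)
Lemma carry_form (r : R) w l l' : absv (l w) = 1 -> absv (l' w) = 1 ->
    mxabs (dual_row b (l - l')) * mxabs (rVof b w) < r ->
  exists2 k, carries k w l w l' & near_one b r k.
Proof.
move=> lw lw' lr; pose m : dual W := (l' w)^-1 *: (l - l').
have lw0 : l' w != 0 by rewrite -absv_eq0 lw' oner_eq0.
have mE v : m v = (l' w)^-1 * (l v - l' v).
  by rewrite scale_lfunE add_lfunE opp_lfunE.
have mz : 1 + m w = (l' w)^-1 * l w.
  by rewrite mE mulrBr mulVf // addrC subrK.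
have [||k kE kr] := @transvection_near w m r.
- by rewrite mz absvM absvV lw lw' invr1 mul1r.
- by rewrite linearZ mxabsZ absvV lw' invr1 mul1r.
exists k => //; split.
  exists (1 + m w); last by rewrite kE scalerDl scale1r.
  by rewrite mz mulf_neq0 ?invr_eq0 // -absv_eq0 lw oner_eq0.
exists 1; rewrite ?oner_eq0 // scale1r; apply/lfunP => v.
have e : l' w * m v = l v - l' v by rewrite mE; exact: mulVKf.
have {}e : m v *: l' w = l v - l' v by rewrite -e; exact: mulrC.
by rewrite comp_lfunE kE linearD linearZ /= e addrC subrK.
Qed.

End Coordinates.

Section Functional.
Variables (u : W) (us : dual W) (T : schwartz_distribution R (GL W)).
Hypothesis T_inv : forall k, carries k u us u us ->
  invariant_under T (GLconj_homeo k).
Implicit Types f : schwartz R (triples W).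

(* The value at (w, l) of the function on the orbit of the base point (u, us)
   deduced from f by integrating against T in the fibres. *)
Definition descent f w l : R[i] := xget 0 [set v | absv (l w) = 1 /\
  exists2 g, carries g u us w l & v = T (slice f g w l)].

(** The two choices differ by [g^-1 g'], which preserves the lines of [u] and [us], so [T] is
    invariant under it. *)
Lemma slice_indep f g g' w l : carries g u us w l -> carries g' u us w l ->
  T (slice f g w l) = T (slice f g' w l).
Proof.
move=> cg cg'; rewrite -(T_inv (carries_comp cg' (carriesV cg))).
congr (T _); apply/val_inj/funext => x /=; congr (schwartz_val f (_, _, _)).
by apply: GL_eq => v; rewrite !GLmulE GLinvM GLinvK !GLVK.
Qed.

Lemma descentE f g w l : absv (l w) = 1 -> carries g u us w l ->
  descent f w l = T (slice f g w l).
Proof.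
move=> lw cg; apply: xget_unique; first by split=> //; exists g.
by move=> v [_ [g' cg' ->]]; exact: slice_indep.
Qed.

Lemma descent_off f w l : ~ (absv (l w) = 1 /\ exists g, carries g u us w l) ->
  descent f w l = 0.
Proof.
by move=> n; apply: xgetPN => v [lw [g cg _]]; apply: n; split=> //; exists g.
Qed.

Lemma descent_linear (a : R[i]) f f' w l :
  descent (a *: f + f') w l = a * descent f w l + descent f' w l.
Proof.
have [[lw [g cg]]|n] := pselect (absv (l w) = 1 /\ exists g, carries g u us w l).
  by rewrite !(descentE _ lw cg) slice_linear linearP.
by rewrite !descent_off // mulr0 addr0.
Qed.

Lemma descent_eq0 f w l : (forall x, f (x, w, l) = 0) -> descent f w l = 0.
Proof.
move=> f0.
have [[lw [g cg]]|n] := pselect (absv (l w) = 1 /\ exists g, carries g u us w l).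
  by rewrite (descentE _ lw cg) slice_eq0 // linear0.
by rewrite descent_off.
Qed.

(** A choice [g] for [(w, l)] gives the choice [h g] for the image pair, and [h] does not change the
    value [l w]. *)
Lemma descent_act f h w l :
  descent (schwartz_comp f (triple_act_homeo h)) w l =
  descent f (h w) (l \o GLinv h)%VF.
Proof.
have ch : carries h w l (h w) (l \o GLinv h)%VF.
  split; first by exists 1; rewrite ?oner_eq0 ?scale1r.
  exists 1; rewrite ?oner_eq0 // scale1r; apply/lfunP => v.
  by rewrite !comp_lfunE GLK.
have lhw : (l \o GLinv h)%VF (h w) = l w by rewrite comp_lfunE GLK.
have [[lw [g cg]]|n] := pselect (absv (l w) = 1 /\ exists g, carries g u us w l).
  rewrite (descentE _ lw cg) (descentE _ _ (carries_comp cg ch)) ?lhw //.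
  congr (T _); apply/val_inj/funext => x /=; congr (schwartz_val f (_, _, _)).
  by apply: GL_eq => v; rewrite !GLmulE GLinvM.
rewrite !descent_off // => -[]; rewrite lhw => lw [g cg]; apply: n; split=> //.
by exists (GLmul (GLinv h) g); exact: carries_comp (carriesV ch).
Qed.

Variable b : (\dim {:W}).-tuple W.
Hypothesis hb : basis_of {:W} b.

Lemma descent_step f k w l w' l' :
    (forall x, f (GLconj k x, w', l') = f (x, w, l)) ->
    absv (l w) = 1 -> absv (l' w') = 1 -> carries k w l w' l' ->
  descent f w l = descent f w' l'.
Proof.
move=> fk lw lw' ck.
have [[g cg]|n] := pselect (exists g, carries g u us w l).
  rewrite (descentE _ lw cg) (descentE _ lw' (carries_comp cg ck)).
  congr (T _); apply/val_inj/funext => x /=; rewrite -fk.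
  congr (schwartz_val f (_, _, _)); apply: GL_eq => v; rewrite !GLmulE.
  by rewrite GLinvM.
rewrite !descent_off // => -[_ [g cg]]; apply: n; last by exists g.
by exists (GLmul (GLinv k) g); exact: carries_comp (carriesV ck).
Qed.

Lemma descent_bounded f : exists2 s : R, 1 <= s & forall w l,
  descent f w l != 0 -> mxabs (rVof b w) < s /\ mxabs (dual_row b l) < s.
Proof.
have [s s1 fs] := schwartz_bounded hb f; exists s => // w l dN0.
have [//|n] := pselect (mxabs (rVof b w) < s /\ mxabs (dual_row b l) < s).
case/eqP: dN0; apply: descent_eq0 => x; apply/eqP; apply: contrapT => /negP.
by move=> /fs.
Qed.

(** Nearby pairs are joined in two moves, from [w] to [w'] with [l] fixed, then from [l] to [l']
    with [w'] fixed. Each move is a transvection near 1, along which [schwartz_uniform] keeps [f]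
    constant. *)
Lemma descent_periodic f : exists2 r : R, 0 < r & forall w l w' l',
    mxabs (rVof b w' - rVof b w) < r -> mxabs (dual_row b l' - dual_row b l) < r ->
  descent f w l = descent f w' l'.
Proof.
have [r r0 fr] := schwartz_uniform hb f; have [s s1 ds] := descent_bounded f.
have s0 : 0 < s := lt_le_trans ltr01 s1.
(* A displacement below [c] times a norm below [s] is less than 1, which preserves [absv (l w) = 1],
   and less than [r], which keeps the transvection near 1. *)
pose c := Num.min r (Num.min 1 r / s).
have c0 : 0 < c by rewrite lt_min r0 divr_gt0 // lt_min ltr01.
have cr : c <= r by rewrite ge_min lexx.
have sm t v : 0 <= t -> t < c -> v < s -> t * v < 1 /\ t * v < r.
  move=> t0 tc vs; apply/andP; rewrite -lt_min (@le_lt_trans _ _ (t * s)) //.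
    by rewrite ler_wpM2l // ltW.
  by rewrite -ltr_pdivlMr // (lt_le_trans tc) // ge_min lexx orbT.
(* Hence a displacement below [c] preserves the region of norms below [s], outside of which
   [descent] vanishes. *)
have cs : c <= s.
  rewrite (le_trans _ s1) // ge_min orbC ler_pdivrMr // mul1r.
  by rewrite ge_min (le_trans _ s1).
exists c => // w l w' l' ww' ll'.
have ws := mxabsBD_lt (lt_le_trans ww' cs).
have ls := mxabsBD_lt (lt_le_trans ll' cs).
have [[wb lb]|nb] :=
  pselect (mxabs (rVof b w) < s /\ mxabs (dual_row b l) < s); last first.
  transitivity (0 : R[i]).
    by apply/eqP; apply: contrapT => /negP /ds.
  by apply/esym/eqP; apply: contrapT => /negP /ds; rewrite ws ls.
have [sl1 slr] := sm _ _ (mxabs_ge0 _) ww' lb.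
have wb' : mxabs (rVof b w') < s by rewrite ws.
have [sw1 swr] := sm _ _ (mxabs_ge0 _) ll' wb'.
have lw1 : absv (l w' - l w) < 1.
  by rewrite -linearB (le_lt_trans (absv_app_le hb _ _)) // linearB.
have lw2 : absv (l' w' - l w') < 1.
  have -> : l' w' - l w' = (l' - l) w' by rewrite add_lfunE opp_lfunE.
  by rewrite (le_lt_trans (absv_app_le hb _ _)) // mulrC dual_rowB.
have near1 (x y : F) : absv (y - x) < 1 -> absv x = 1 -> absv y = 1.
  by move=> yx x1; rewrite -x1; apply: absv_near; rewrite x1.
have [lw|lw] := pselect (absv (l w) = 1); last first.
  rewrite !descent_off // => -[lw' _]; apply: lw => //.
  apply: (near1 (l w')); first by rewrite absvB.
  by apply: near1 lw'; rewrite absvB.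
have lw' := near1 _ _ lw1 lw; have lw'' := near1 _ _ lw2 lw'.
have [|k ck kr] := @carry_vector b hb r w w' l lw lw'; first by rewrite mulrC linearB.
have [|k' ck' kr'] := @carry_form b hb r w' l l' lw' lw''.
  by rewrite dual_rowB mxabsB.
rewrite (descent_step (w' := w') (l' := l) _ lw lw' ck); last first.
  by move=> x; apply: fr => //; [exact: lt_le_trans ww' cr|rewrite subrr mxabs0].
apply: (descent_step _ lw' lw'' ck') => x; apply: fr => //.
  by rewrite subrr mxabs0.
exact: lt_le_trans ll' cr.
Qed.

End Functional.
End Descent.

(** * The distribution on triples induced from [T] *)

Section InducedDistribution.
Variables (R : realType) (F : nonArchLocalFieldType R) (W : vectType F).
Variable b : (\dim {:W}).-tuple W.
Hypothesis hb : basis_of {:W} b.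
Local Notation m := (\dim {:W}).
Variables (u : W) (us : dual W) (T : schwartz_distribution R (GL W)).
Hypothesis T_inv : forall k, carries k u us u us ->
  invariant_under T (GLconj_homeo k).
Implicit Types (f g : schwartz R (triples W)) (w : W) (l : dual W).
Implicit Types phi : schwartz R (GL W).

Definition form_of (y : 'rV[F]_m) : dual W := dual_basis_map b (vecof b y).

Lemma form_ofK y : dual_row b (form_of y) = y.
Proof. by rewrite dual_row_basis_map // vecofK. Qed.

Lemma dual_rowVK l : form_of (dual_row b l) = l.
Proof. exact: dual_rowK. Qed.

Definition descent_coord f (z : 'rV[F]_(m + m)) : R[i] :=
  descent u us T f (vecof b (lsubmx z)) (form_of (rsubmx z)).

Lemma test_descent_coord f : exists2 r, 0 < r & test_function r (descent_coord f).
Proof.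
have [r r0 fr] := descent_periodic T_inv hb f.
have [s s1 fs] := descent_bounded T_inv hb f.
exists r => //; split=> [x y|].
  rewrite mxabsB -[y - x]hsubmxK mxabs_row_mx => /andP[h1 h2].
  by apply: fr; rewrite ?vecofK ?form_ofK // -linearB.
exists s => z /fs; rewrite vecofK // form_ofK => -[h1 h2].
by rewrite -[z]hsubmxK mxabs_row_mx h1.
Qed.

Definition induced f : R[i]^o := haar (descent_coord f).

Lemma induced_linear : linear induced.
Proof.
move=> a f g; have [r r0 fr] := test_descent_coord f.
have [s s0 gs] := test_descent_coord g; pose q := Num.min r s.
have q0 : 0 < q by rewrite lt_min r0.
have {}fr : test_function q (descent_coord f) by apply: test_le fr; rewrite ge_min lexx.
have {}gs : test_function q (descent_coord g).
  by apply: test_le gs; rewrite ge_min lexx orbT.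
rewrite /induced; have -> : descent_coord (a *: f + g) =
    (fun z => a * descent_coord f z + descent_coord g z).
  by apply/funext => z; exact: descent_linear.
exact: haar_linear q0 fr gs.
Qed.

Definition induced_distribution : schwartz_distribution R (triples W) :=
  HB.pack_for (schwartz_distribution R (triples W)) induced
    (GRing.isLinear.Build R[i] (schwartz R (triples W)) R[i]^o _ induced
      induced_linear).

Lemma descent_coord_act f (h : GL W) z :
  descent_coord (schwartz_comp f (triple_act_homeo h)) z =
  descent_coord f (z *m block_mx (mxof b b h) 0 0 (invmx (mxof b b h))^T).
Proof.
rewrite /descent_coord descent_act // -{3 4}(hsubmxK z) mul_row_block.
rewrite !mulmx0 addr0 add0r row_mxKl row_mxKr.
rewrite -[h (vecof b _)](rVofK hb) (rVof_app _ hb) vecofK //; congr descent.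
apply: (can_inj dual_rowVK).
by rewrite dual_row_comp // !form_ofK mxof_GLinv.
Qed.

(** On coordinates of pairs, [h] acts by the block matrix of [h] and its contragredient, whose
    modulus is 1. *)
Lemma induced_invariant h :
  invariant_under induced_distribution (triple_act_homeo h).
Proof.
move=> f; change (induced (schwartz_comp f (triple_act_homeo h)) = induced f).
have [r r0 fr] := test_descent_coord f; rewrite /induced.
have -> : descent_coord (schwartz_comp f (triple_act_homeo h)) = fun z =>
    descent_coord f (z *m block_mx (mxof b b h) 0 0 (invmx (mxof b b h))^T).
  by apply/funext => z; rewrite descent_coord_act.
have uh := mxof_GL_unit hb h.
have ub : block_mx (mxof b b h) 0 0 (invmx (mxof b b h))^T \in unitmx.
  rewrite unitmxE det_ublock unitrM -!unitmxE uh.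
  by rewrite unitmx_tr unitmx_inv.
by rewrite (haar_mulmx ub r0 fr) modulus_block_inv // mul1r.
Qed.

Hypothesis us_u : absv (us u) = 1.

Lemma descent_congr f g w l : (forall x, f (x, w, l) = g (x, w, l)) ->
  descent u us T f w l = descent u us T g w l.
Proof.
move=> fg; apply/eqP; rewrite -subr_eq0; apply/eqP.
have -> : descent u us T f w l = descent u us T (1 *: (f - g) + g) w l.
  by rewrite scale1r subrK.
rewrite (descent_linear T_inv) mul1r addrK (descent_eq0 T_inv) // => x.
by change (f (x, w, l) - g (x, w, l) = 0); rewrite fg subrr.
Qed.

(** The period of [descent] depends on the function, so it is taken once, for the ball of radius 1.
    For small [r] the two tensors agree on the fibres over the smaller ball, where the descent is
    constant and equal to its value [T phi] at the base point. *)
Lemma descent_tensor phi : exists2 r0 : R, 0 < r0 & forall r, 0 < r -> r <= r0 ->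
  forall w l, descent u us T (tensor_ball hb phi u us r) w l = T phi *
    ((mxabs (rVof b w - rVof b u) < r) && (mxabs (dual_row b l - dual_row b us) < r))%:R.
Proof.
have [r0 r00 per] := descent_periodic T_inv hb (tensor_ball hb phi u us 1).
exists (Num.min r0 1) => [|r rpos]; first by rewrite lt_min r00 ltr01.
rewrite le_min => /andP[rr0 r1] w l.
have [/andP[hw hl]|out] := boolP (_ && _); last first.
  rewrite mulr0 descent_eq0 // => x.
  change (phi x * (base_ball b u us r (x, w, l))%:R = 0).
  by rewrite /base_ball (negPf out) mulr0.
rewrite mulr1 (descent_congr (g := tensor_ball hb phi u us 1)); last first.
  move=> x; change (phi x * (base_ball b u us r (x, w, l))%:R =
    phi x * (base_ball b u us 1 (x, w, l))%:R).
  by rewrite /base_ball hw hl (lt_le_trans hw r1) (lt_le_trans hl r1).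
rewrite -(per u us w l); [|exact: lt_le_trans rr0|exact: lt_le_trans rr0].
have id_inj : lker (\1%VF : 'End(W)) == 0%VS.
  by apply/lker0P => v v'; rewrite !id_lfunE.
pose i : GL W := Sub \1%VF id_inj.
have iE v : i v = v by rewrite /= id_lfunE.
have ci : carries i u us u us.
  split; exists 1; rewrite ?oner_eq0 // scale1r ?iE //.
  by apply/lfunP => v; rewrite comp_lfunE iE.
rewrite (descentE T_inv _ us_u ci); congr (T _); apply/val_inj/funext => x.
change (phi (GLconj i x) * (base_ball b u us 1 (GLconj i x, u, us))%:R = phi x).
rewrite /base_ball !subrr !mxabs0 ltr01 mulr1; congr (phi _).
by apply: GL_eq => v; rewrite !GLmulE iE -{2}(GLVK i v) iE.
Qed.

Lemma induced_tensor phi : exists2 r0 : R, 0 < r0 & forall r, 0 < r -> r <= r0 ->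
  induced (tensor_ball hb phi u us r) =
    T phi * haar (@ball_ind _ F R[i] (m + m) r).
Proof.
have [r0 r00 H] := descent_tensor phi; exists r0 => // r rpos rr0.
pose z0 := row_mx (rVof b u) (dual_row b us).
have tb : test_function r (@ball_ind _ F R[i] (m + m) r) := test_ball _ _ _ rpos.
rewrite -(haar_translate (- z0) rpos tb).
rewrite -(haarZ _ rpos (test_translate (- z0) tb)).
rewrite /induced; congr haar; apply/funext => z.
rewrite /descent_coord H // vecofK // form_ofK /ball_ind -mxabs_row_mx.
by congr (_ * _%:R); rewrite -{3}[z]hsubmxK /z0 opp_row_mx add_row_mx.
Qed.

End InducedDistribution.

(** * The stabilizer of the base point, and [sigma] in coordinates *)

Section AdaptedBasis.
Variables (R : realType) (F : nonArchLocalFieldType R) (W : vectType F).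
Variables (V U : {vspace W}) (VU1 : (V + U)%VS = fullv) (VU0 : (V :&: U)%VS = 0%VS).
Implicit Types (w v : W) (us : dual W).

(* An element preserving the lines of u and u^* acts by conjugation as an
   element of GL(V): divide it by its eigenvalue on u. *)
Lemma carries_extend (u : W) (us : dual W) (k : GL W) :
    (forall v, (v \in V) = (us v == 0)) -> us u = 1 -> U = <[u]>%VS ->
    carries k u us u us ->
  exists g : GL (subvs_of V), GLconj (GLextend VU1 VU0 g) =1 GLconj k.
Proof.
move=> VE usu UE [[a a0 ku] [c c0 kus]].
have kV v : v \in V -> k v \in V.
  rewrite !VE => /eqP v0; have /lfunP/(_ v) := kus.
  by rewrite comp_lfunE scale_lfunE v0 => ->; rewrite scaler0.
pose f (v : subvs_of V) : subvs_of V := vsproj V (a^-1 *: k (vsval v)).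
have fE (v : subvs_of V) : vsval (f v) = a^-1 *: k (vsval v).
  by rewrite vsprojK // memvZ ?kV ?subvsP.
have f_lin : linear f.
  move=> d v w; apply: val_inj.
  change (vsval (f (d *: v + w)) = d *: vsval (f v) + vsval (f w)).
  by rewrite !fE !linearP.
pose fL := HB.pack_for {linear subvs_of V -> subvs_of V} f
  (GRing.isLinear.Build F (subvs_of V) (subvs_of V) _ f f_lin).
have gE (v : subvs_of V) : linfun fL v = f v by rewrite lfunE.
have g_inj : lker (linfun fL) == 0%VS.
  apply/lker0P => v w; rewrite !gE => /(congr1 vsval); rewrite !fE.
  by move=> /(scalerI (invr_neq0 a0))/GL_inj/val_inj.
pose g : GL (subvs_of V) := Sub (linfun fL) g_inj; exists g.
have eE' v t : v \in V ->
    GLextend VU1 VU0 g (v + t *: u) = a^-1 *: k (v + t *: u).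
  move=> vV; have uU : u \in U by rewrite UE memv_line.
  have -> : k (v + t *: u) = k v + t *: (a *: u) by rewrite linearD linearZ /= ku.
  rewrite scalerDr !scalerA mulrAC mulVf // mul1r linearD linearZ /=.
  have -> : GLextend VU1 VU0 g u = u by exact: extend_end_right.
  congr (_ + _).
  by rewrite -[in LHS](vsprojK vV) extend_end_left // gE fE vsprojK.
have eE w : GLextend VU1 VU0 g w = a^-1 *: k w.
  have wV : w - us w *: u \in V.
    by rewrite VE linearB linearZ /= usu [_ *: 1]mulr1 subrr.
  by have := eE' _ (us w) wV; rewrite subrK.
have eVE w : GLinv (GLextend VU1 VU0 g) w = a *: GLinv k w.
  apply: (GL_inj (g := GLextend VU1 VU0 g)).
  by rewrite GLVK eE linearZ /= GLVK scalerA mulVf // scale1r.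
move=> x; apply: GL_eq => w; rewrite !GLmulE eE eVE.
have -> : k (x (a *: GLinv k w)) = a *: k (x (GLinv k w)) by rewrite !linearZ.
by rewrite scalerK.
Qed.

End AdaptedBasis.

Section SigmaTranspose.
Variables (R : realType) (F : nonArchLocalFieldType R) (W : vectType F).
Variable b : (\dim {:W}).-tuple W.
Hypothesis hb : basis_of {:W} b.

(** The map [dual_basis_map b] sends a vector to the form with the same coordinates, and
    precomposing a form with [x] multiplies its row by the transposed matrix. *)
Lemma sigma_GL_transpose (x : GL W) : sigma_GL hb x = transpose_GL hb x.
Proof.
apply: GL_eq => v; apply: (can_inj (rVofK hb)).
change (rVof b (sigma_end b x v) = rVof b (transpose_end b x v)).
rewrite -(dual_row_basis_map hb) -(rVof_mul hb) //.
have -> : dual_basis_map b (sigma_end b x v) = (dual_basis_map b v \o x)%VF.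
  by apply/lfunP => w; rewrite (sigma_endE hb) comp_lfunE.
by rewrite (dual_row_comp hb) (dual_row_basis_map hb).
Qed.

(** [sigma] exchanges the coordinates of the vector and of the form; those of the centre are equal,
    so the ball is preserved. *)
Lemma tensor_ball_sigma (phi : schwartz R (GL W)) (u : W) (r : R) :
  schwartz_comp (tensor_ball hb phi u (dual_basis_map b u) r) (sigma_homeo hb) =
  tensor_ball hb (schwartz_comp phi (transpose_homeo hb)) u (dual_basis_map b u) r.
Proof.
apply/val_inj/funext => -[[x w] l].
change (phi (sigma_GL hb x) *
    (base_ball b u (dual_basis_map b u) r (sigma hb (x, w, l)))%:R =
  phi (transpose_GL hb x) * (base_ball b u (dual_basis_map b u) r (x, w, l))%:R).
rewrite sigma_GL_transpose /base_ball /= !(rVof_basis_mapV hb).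
by rewrite !(dual_row_basis_map hb) andbC.
Qed.

End SigmaTranspose.

(** * From invariance under [sigma] to invariance under transposition *)

Theorem mainTheorem5 (R : realType) :
  (forall (F : nonArchLocalFieldType R) (V : vectType F)
      (e : (\dim {:V}).-tuple V) (he : basis_of {:V} e)
      (T : schwartz_distribution R (triples V)),
    [pchar F] =i pred0 ->
    (forall g : GL V, invariant_under T (triple_act_homeo g)) ->
    invariant_under T (sigma_homeo he)) ->
  forall (F : nonArchLocalFieldType R) (W : vectType F) (V U : {vspace W})
      (n : nat) (VU1 : (V + U)%VS = fullv) (VU0 : (V :&: U)%VS = 0%VS)
      (b : (\dim {:W}).-tuple W) (hb : basis_of {:W} b)
      (T : schwartz_distribution R (GL W)),
    [pchar F] =i pred0 ->
    \dim V = n -> \dim {:W} = n.+1 -> (2 <= n.+1)%N ->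
    adapted_basis V U b ->
    (forall g : GL (subvs_of V),
      invariant_under T (GLconj_homeo (GLextend VU1 VU0 g))) ->
    invariant_under T (transpose_homeo hb).
Proof.
move=> sigma_inv F W V U n VU1 VU0 b hb T F0 dV dW _ [e [u [he uU u0 bE]]] Tinv phi.
have /andP[/eqP spE /eqP frE] := he.
have se : size e = n by rewrite -frE spE.
have nW : (n < \dim {:W})%N by rewrite dW.
pose i0 : 'I_(\dim {:W}) := Ordinal nW.
have uE : u = b`_i0 by rewrite bE nth_rcons se ltnn eqxx.
(* Taking [us] to be the image of [u] under the map defining [sigma] makes the pair [(u, us)] fixed
   by [sigma]; as [u] is the last vector of [b], [us] is also its coordinate form. *)
pose us := dual_basis_map b u.
have usE v : us v = coord b i0 v.
  by rewrite /us dual_basis_mapC uE dual_basis_map_basis.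
have usu : us u = 1 by rewrite usE uE coord_free ?(basis_free hb) // eqxx.
have eb (i : 'I_(\dim {:W})) : i != i0 -> b`_i \in V.
  move=> ii0; have lin : (i < n)%N.
    have := ltn_ord i; rewrite [X in (_ < X)%N]dW ltnS leq_eqVlt.
    by case/orP => // /eqP i_n; case/eqP: ii0; exact: val_inj.
  by rewrite bE nth_rcons se lin -spE memv_span // mem_nth // se.
have VE v : (v \in V) = (us v == 0).
  apply/idP/eqP => [vV|usv].
    rewrite -spE in vV.
    have -> : v = \sum_(j < size e) coord (in_tuple e) j v *: e`_j.
      exact: (coord_span (X := in_tuple e)).
    rewrite linear_sum big1 // => j _; rewrite linearZ /= usE.
    have jW : (j < \dim {:W})%N by rewrite dW ltnW // ltnS -se ltn_ord.
    have -> : e`_j = b`_(Ordinal jW) by rewrite bE nth_rcons /= ltn_ord.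
    rewrite coord_free ?(basis_free hb) // -val_eqE /= ltn_eqF ?mulr0n ?scaler0 //.
    by rewrite -se ltn_ord.
  rewrite (coord_basis hb (memvf v)) memv_suml // => i _.
  have [->|ii0] := eqVneq i i0; first by rewrite -usE usv scale0r mem0v.
  by rewrite memvZ // eb.
(* The complement [U] has dimension [n + 1 - n = 1] and contains the nonzero vector [u]. *)
have UE : U = <[u]>%VS.
  apply/eqP; rewrite eq_sym eqEdim -memvE uU dim_vline u0 /=.
  have := dimv_add_leqif V U; have := dimv_disjoint_sum VU0.
  rewrite VU1 dW dV => d _; suff -> : \dim U = 1%N by [].
  by apply/eqP; rewrite -(eqn_add2l n) -d addn1.
have T_inv k : carries k u us u us -> invariant_under T (GLconj_homeo k).
  move=> /(carries_extend VU1 VU0 VE usu UE)[g gk] f.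
  rewrite -(Tinv g f); congr (T _); apply/val_inj/funext => x /=.
  by rewrite gk.
have us1 : absv (us u) = 1 by rewrite usu absv1.
have [r1 r10 S1] := induced_tensor hb T_inv us1 phi.
have [r2 r20 S2] := induced_tensor hb T_inv us1 (schwartz_comp phi (transpose_homeo hb)).
(* The radius must suit both [phi] and its transpose, and be at most 1 for [haar_ball_neq0], which
   allows the final cancellation. *)
pose r := Num.min (Num.min r1 r2) 1.
have r0 : 0 < r by rewrite !lt_min r10 r20 ltr01.
have rr1 : r <= r1 by rewrite !ge_min lexx.
have rr2 : r <= r2 by rewrite !ge_min lexx orbT.
have rle1 : r <= 1 by rewrite ge_min lexx orbT.
(* The hypothesis is applied to the whole space [W] with the basis [b], not to [V]. *)
have := sigma_inv F W b hb (induced_distribution hb T_inv) F0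
  (induced_invariant hb T_inv) (tensor_ball hb phi u us r).
rewrite tensor_ball_sigma; move: (S1 r r0 rr1) (S2 r r0 rr2).
move=> E1 E2 E; have {}E := etrans (esym E2) (etrans E E1).
exact: (mulIf (haar_ball_neq0 _ _ _ r0 rle1) E).
Qed.
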